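(* Let $G$ be a finite primitive permutation group. If $G$ contains a quasi-semiregular element, then $G$ is of O'Nan–Scott type HA, AS, PA, SD or CD. Furthermore: (a) if $G$ is a maximal group of type SD with $\mathrm{soc}(G)=T^k$ (i.e. $G=W=T^k.(\mathrm{Out}(T)\times \mathrm{Sym}(k))$ as defined in the context), then $G$ contains quasi-semiregular elements if and only if $k$ is prime and $\gcd(|T|,k)=1$; (b) if $G$ is a maximal product action group $H\wr \mathrm{Sym}(\ell)$ (of type PA or CD) acting in product action on $\Delta^\ell$, where $H$ is a primitive group on $\Delta$ of type AS or SD, then $G$ contains quasi-semiregular elements in its action on $\Delta^\ell$ if and only if $H$ contains quasi-semiregular elements in its action on $\Delta$.
   Context: A permutation group $G$ on $\Omega$ is semiregular if only the identity fixes a point. A permutation group is quasi-semiregular if it has a unique fixed point and acts semiregularly on the remaining points; a permutation $g$ is quasi-semiregular if $\langle g\rangle$ is quasi-semiregular. The O'Nan–Scott types of finite primitive groups are HA (affine), AS (almost simple), HS (holomorph of a nonabelian simple group), HC (holomorph of a composite nonabelian group), SD (simple diagonal), CD (compound diagonal), PA (product action), TW (twisted wreath). Maximal SD group: for $k\ge 2$ and a nonabelian finite simple group $T$, let $N=T^k$, $D=\{(t,\dots,t):t\in T\}$, $\Omega=[N:D]$ (right cosets). $\sigma\in\mathrm{Sym}(k)$ acts by $D(t_1,\dots,t_k)\mapsto D(t_{1\sigma^{-1}},\dots,t_{k\sigma^{-1}})$ and $\alpha\in\mathrm{Aut}(T)$ by $D(t_1,\dots,t_k)\mapsto D(t_1^\alpha,\dots,t_k^\alpha)$;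 $N$ acts by right multiplication. $W=T^k.(\mathrm{Out}(T)\times\mathrm{Sym}(k))$ is the group generated by $N$ and all such $\sigma$ and $\alpha$; it is primitive on $\Omega$. *)

(* Defs.v *)
From HB Require Import structures.
From mathcomp Require Import all_boot all_fingroup all_solvable.

Set Implicit Arguments.
Unset Strict Implicit.
Unset Printing Implicit Defensive.

Local Open Scope group_scope.

Section Socle.
Variable gT : finGroupType.

Definition minnormal_sub (M G : {set gT}) :=
  [min M of H | (H :!=: 1) && (H <| G)].

Definition minnormals (G : {set gT}) : {set {group gT}} :=
  [set M : {group gT} | minnormal_sub M G].

Definition socle (G : {set gT}) : {set gT} :=
  <<\bigcup_(M in minnormals G) gval M>>.

End Socle.

(* A acting on S (via to) is quasi-semiregular: A has a unique fixed point
   a in S and acts semiregularly on S \ {a}.  Semiregularity is measured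
   for the permutation group induced on S: an element of A fixing some
   point of S \ {a} must act trivially on S.  For a faithful permutation
   group (G <= Sym(S) with the natural action 'P and S = setT) the
   condition 'C_A[x | to] \subset 'C(S | to) is exactly 'C_A[x | 'P] = 1. *)
Definition quasi_semiregular (aT : finGroupType) (D : {group aT})
    (rT : finType) (to : action D rT) (A : {set aT}) (S : {set rT}) :=
  exists2 a, 'Fix_(S | to)(A) = [set a] &
    forall x, x \in S :\ a -> 'C_A[x | to] \subset 'C(S | to).

Definition qsr_element (aT : finGroupType) (D : {group aT})
    (rT : finType) (to : action D rT) (S : {set rT}) (g : aT) :=
  quasi_semiregular to <[g]> S.

Section ONanScott.
Variable Om : finType.
Implicit Types (G : {group {perm Om}}) (a : Om).

Definition soc_stab G a := 'C_(socle G)[a | 'P].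

(* the simple direct factors T_1, ..., T_k of N = soc(G) (when N is a
   nonabelian minimal normal subgroup, these are exactly the minimal normal
   subgroups of N) *)
Definition soc_factors G := minnormals (socle G).

(* the projection of N_a to the factor Ti is onto: since
   C_N(Ti) = prod_{j <> i} T_j, this is N_a * C_N(Ti) = N. *)
Definition full_projections G a :=
  forall Ti : {group {perm Om}}, Ti \in soc_factors G ->
    soc_stab G a * 'C_(socle G)(Ti) = socle G.

(* G has a unique minimal normal subgroup, nonabelian and not simple,
   i.e. soc(G) = T^k with k >= 2 *)
Definition uniq_nonab_socle G :=
  [/\ #|minnormals G| = 1%N, ~~ abelian (socle G) & ~~ simple (socle G)].

Definition type_HA G := abelian (socle G).

Definition type_HS G :=
  [/\ ~~ abelian (socle G), #|minnormals G| = 2%N &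
      forall M : {group {perm Om}}, M \in minnormals G -> simple M].

Definition type_HC G :=
  [/\ ~~ abelian (socle G), #|minnormals G| = 2%N &
      forall M : {group {perm Om}}, M \in minnormals G -> ~~ simple M].

Definition type_AS G := simple (socle G) /\ ~~ abelian (socle G).

Definition type_TW G :=
  uniq_nonab_socle G /\ forall a, soc_stab G a = 1.

(* N_a is a full diagonal subgroup: N_a ~= T and all projections onto *)
Definition type_SD G :=
  uniq_nonab_socle G /\
  forall a, [/\ soc_stab G a != 1, full_projections G a &
     exists2 Ti : {group {perm Om}}, Ti \in soc_factors G & soc_stab G a \isog Ti].

(* N_a is subdirect (all projections onto) but not a full diagonal *)
Definition type_CD G :=
  uniq_nonab_socle G /\
  forall a, [/\ soc_stab G a != 1, full_projections G a &
     forall Ti : {group {perm Om}}, Ti \in soc_factors G -> ~~ (soc_stab G a \isog Ti)].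

Definition type_PA G :=
  uniq_nonab_socle G /\
  forall a, soc_stab G a != 1 /\ ~ full_projections G a.

End ONanScott.

Section FunPerms.

Definition setperm (U : finType) (p : {perm U}) : {perm {set U}} :=
  perm (imset_inj (@perm_inj _ p)).

Variables (k : nat) (U : finType).
Notation fT := {ffun 'I_k -> U}.

Lemma coordperm_inj (q : 'I_k -> {perm U}) :
  injective (fun f : fT => [ffun i => q i (f i)]).
Proof.
move=> f g /ffunP e; apply/ffunP=> i; move: (e i); rewrite !ffunE.
exact: perm_inj.
Qed.

Definition coordperm (q : 'I_k -> {perm U}) : {perm fT} :=
  perm (@coordperm_inj q).

Lemma shiftperm_inj (s : 'S_k) : injective (fun f : fT => [ffun i => f (s^-1 i)]).
Proof.
move=> f g /ffunP e; apply/ffunP=> i; move: (e (s i)); rewrite !ffunE.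
by rewrite permK.
Qed.

Definition shiftperm (s : 'S_k) : {perm fT} := perm (@shiftperm_inj s).

End FunPerms.

Section MaxSD.
Variables (gT : finGroupType) (T : {group gT}) (k : nat).
Notation fT := {ffun 'I_k -> gT}.

Lemma rmul_inj (t : fT) : injective (fun f : fT => [ffun i => f i * t i]).
Proof.
move=> f g /ffunP e; apply/ffunP=> i; move: (e i); rewrite !ffunE.
exact: mulIg.
Qed.

Definition rmulperm (t : fT) : {perm fT} := perm (@rmul_inj t).

Definition powT : {set fT} := [set f : fT | [forall i, f i \in T]].

Definition diagT : {set fT} := [set [ffun=> t] | t in T].

Definition rcosetD (f : fT) : {set fT} :=
  [set [ffun i => (d : fT) i * f i] | d in diagT].

Definition SD_Omega : {set {set fT}} := [set rcosetD f | f in powT].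

(* W, generated (as a permutation group of the finite type {set fT}, acting
   on the subset SD_Omega by images of cosets) by the right multiplications
   by elements of N, the coordinate permutations sigma in Sym(k) and the
   diagonal automorphisms alpha in Aut(T) *)
Definition SD_W : {group {perm {set fT}}} :=
  <<[set setperm (rmulperm t) | t in powT]
    :|: [set setperm (shiftperm gT s) | s in [set: 'S_k]]
    :|: [set setperm (coordperm (fun _ : 'I_k => a)) | a in Aut T]>>%G.

End MaxSD.

Section Wreath.
Variables (Delta : finType) (H : {group {perm Delta}}) (l : nat).

Definition wreath_base : {set {ffun 'I_l -> {perm Delta}}} :=
  [set h : {ffun 'I_l -> {perm Delta}} | [forall i, h i \in H]].

Definition wreath_PA : {group {perm {ffun 'I_l -> Delta}}} :=
  <<[set coordperm (fun i => (h : {ffun 'I_l -> {perm Delta}}) i) | h in wreath_base]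
    :|: [set shiftperm Delta s | s in [set: 'S_l]]>>%G.

End Wreath.

(* Main.v *)
Require Import Defs.
From mathcomp Require Import all_boot all_algebra all_fingroup all_solvable all_character.

Set Implicit Arguments.
Unset Strict Implicit.
Unset Printing Implicit Defensive.

Import GroupScope.

(* The core is Thompson's theorem: a finite group K with a fixed-point-free
   automorphism x of prime order is nilpotent.  A prime-order power of a
   quasi-semiregular element centralises no nontrivial element of a normal
   subgroup acting regularly, so a nonabelian socle, or one of two minimal
   normal subgroups, cannot be regular: this excludes HS, HC and TW.  In (a),
   the element stabilises a coset and acts as (b, s) in Aut(T) x Sym(k);
   uniqueness of the fixed coset forces s to be a single k-cycle of prime
   length (s = 1 would make b fixed-point-free on T) and b to fix no element of
   order k in T.  In (b), a nontrivial cycle of s would give a whole diagonal of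
   fixed points, so s = 1 and every coordinate is quasi-semiregular.

   Thompson's theorem follows from his normal p-complement theorem for odd p,
   applied to the x-invariant Sylow p-subgroup: normalisers of its
   characteristic subgroups are x-invariant, hence nilpotent by induction.  For
   that theorem a minimal counterexample is a {p,q}-group G with X = O_p(G) and
   an abelian minimal normal subgroup K / X of G / X that is a q-group; some
   elementary abelian A of maximal order is not inside X, so A acts on
   W = Omega_1(Z(X)) with |W : C_W(A)| <= |A : A /\ X|, which yields an element
   acting quadratically on a subgroup of W and not commuting with a q-group
   acting there, contrary to p being odd. *)

(** * Normal p-complements: fusion, transfer and Frobenius' criterion *)

Section Pnilpotent.

Variable p : nat.

(** Existence of a normal p-complement, phrased through the p'-core because the complement can only
    be that subgroup. *)
Definition pnilpotent (gT : finGroupType) (G : {set gT}) :=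
  p^'.-Hall(G) 'O_p^'(G).

Section Basics.

Variable gT : finGroupType.
Implicit Types G H K M P Q D X : {group gT}.

Lemma normal_p'Hall_pnilpotent G K :
  K <| G -> p^'.-group K -> p.-nat #|G : K| -> pnilpotent G.
Proof.
move=> nsKG p'K pGK.
have hallK: p^'.-Hall(G) K.
  by rewrite /pHall normal_sub // p'K /=; apply: sub_in_pnat pGK => q _; rewrite !inE negbK.
by rewrite /pnilpotent (normal_Hall_pcore hallK nsKG).
Qed.

Lemma pnilpotent_index G : pnilpotent G -> p.-nat #|G : 'O_p^'(G)|.
Proof. by case/and3P=> _ _; apply: sub_in_pnat => q _; rewrite !inE negbK. Qed.

Lemma pnilpotentS G H : H \subset G -> pnilpotent G -> pnilpotent H.
Proof.
move=> sHG pG; set K := 'O_p^'(G)%G; have nsKG: K <| G := pcore_normal _ _.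
apply: (@normal_p'Hall_pnilpotent H (H :&: K)).
- by rewrite /normal subsetIl normsI ?normG // (subset_trans sHG) ?normal_norm.
- by apply: pgroupS (subsetIr _ _) (pcore_pgroup _ _).
rewrite indexgI -card_quotient ?(subset_trans sHG) ?normal_norm //.
have: p.-group (G / K) by rewrite /pgroup card_quotient ?normal_norm ?pnilpotent_index.
by apply: pgroupS; apply: quotientS.
Qed.

Lemma pnilpotentJ G x : pnilpotent (G :^ x) = pnilpotent G.
Proof. by rewrite /pnilpotent pcoreJ pHallJ2. Qed.

Lemma pnilpotent_of_normal G M :
  M <| G -> p.-group (G / M) -> pnilpotent M -> pnilpotent G.
Proof.
move=> nsMG pGM pM; have nMG := normal_norm nsMG.
apply: (@normal_p'Hall_pnilpotent G 'O_p^'(M)).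
- exact: gFnormal_trans.
- exact: pcore_pgroup.
rewrite -(Lagrange_index (normal_sub nsMG) (pcore_sub _ _)) pnatM pnilpotent_index // andbT.
by rewrite -card_quotient.
Qed.

Lemma pnilpotent_p'pcore_cent G X :
  pnilpotent G -> X <| G -> p.-group X -> 'O_p^'(G) \subset 'C(X).
Proof.
move=> pG nsXG pX; have nKX: X \subset 'N('O_p^'(G)).
  by rewrite (subset_trans (normal_sub nsXG)) ?gFnorm.
apply/commG1P/trivgP; rewrite -(TI_pcoreC p G G) subsetI.
rewrite (subset_trans _ (pcore_max pX nsXG)) ?commg_subl ?commg_subr //=.
by rewrite (subset_trans (pcore_sub _ _)) ?normal_norm.
Qed.

(** Turns local p-nilpotence into the hypothesis of Frobenius' criterion: the p'-core of N_G(D)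
    centralises the normal p-subgroup D. *)
Lemma pnilpotent_norm_cent G D :
  p.-group D -> D \subset G -> pnilpotent 'N_G(D) -> p.-group ('N_G(D) / 'C(D)).
Proof.
move=> pD sDG pN; have nsD: D <| 'N_G(D) by rewrite normal_subnorm.
have sKC := pnilpotent_p'pcore_cent pN nsD pD.
rewrite /pgroup card_quotient ?(subset_trans (subsetIr _ _)) ?cent_norm //.
by apply: pnat_dvd (pnilpotent_index pN); rewrite indexgS.
Qed.

End Basics.

(** * Fusion and transfer in Sylow subgroups *)

Section Fusion.

Variable gT : finGroupType.
Implicit Types G P S D : {group gT}.

(** Induction on |G| - |D| for D = S :&: P. Sylow subgroups [S1], [P1] of N_G(D) above N_S(D),
    N_P(D) are conjugate by some [c] in C_G(D). A Sylow subgroup [R] of G above [S1] meets S in more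
    than D, and [R :^ c] meets P in more than D, so induction joins S to [R] and [R :^ c] to P. *)
Lemma Sylow_cent_setI_trans G P S :
    (forall D, D \subset G -> p.-group D -> p.-group ('N_G(D) / 'C(D))) ->
    p.-Sylow(G) S -> p.-Sylow(G) P ->
  exists2 c, c \in 'C_G(S :&: P) & P :=: S :^ c.
Proof.
move=> locG; have [m] := ubnP (#|G| - #|S :&: P|)%N.
elim: m S P => // m IHm S P lem sylS sylP.
have [sSG pS _] := and3P sylS; have [sPG pP _] := and3P sylP.
have [eqSP | neSP] := eqVneq (S :&: P) S.
  exists 1; first exact: group1.
  have sSP: S \subset P by apply/setIidPl.
  rewrite conjsg1; apply/esym/eqP; rewrite eqEcard sSP.
  by rewrite (card_Hall sylP) (card_Hall sylS) leqnn.
pose D := (S :&: P)%G; have sDS: D \subset S := subsetIl _ _.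
have sDP: D \subset P := subsetIr _ _.
have sDG: D \subset G by apply: subset_trans sSG.
have pD : p.-group D := pgroupS sDS pS.
have prDS: D \proper S by rewrite properEneq neSP.
have prDP: D \proper P.
  by rewrite properEcard sDP (card_Hall sylP) -(card_Hall sylS) proper_card.
have prNS: D \proper 'N_S(D) := nilpotent_proper_norm (pgroup_nil pS) prDS.
have prNP: D \proper 'N_P(D) := nilpotent_proper_norm (pgroup_nil pP) prDP.
have ltD (E1 : {group gT}) : D \proper E1 -> E1 \subset G -> (#|G| - #|E1| < m)%N.
  move=> prE sEG; rewrite -ltnS (leq_trans _ lem) // ltnS ltn_sub2l //.
    by apply: proper_card; apply: proper_sub_trans prE sEG.
  exact: proper_card.
pose N := 'N_G(D)%G.
have sNSN: 'N_S(D) \subset N by rewrite setSI.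
have sNPN: 'N_P(D) \subset N by rewrite setSI.
have [S1 sylS1 sNS1] := Sylow_superset sNSN (pgroupS (subsetIl _ _) pS).
have [P1 sylP1 sNP1] := Sylow_superset sNPN (pgroupS (subsetIl _ _) pP).
have [sS1N pS1 _] := and3P sylS1.
have [n Nn def_P1] := Sylow_trans sylS1 sylP1.
(* N / C(D) is a p-group, so it is already covered by the Sylow subgroup [S1]. *)
have sNCS: N \subset 'C_N(D) * S1.
  have nCN: N \subset 'N('C(D)) by rewrite (subset_trans (subsetIr _ _)) ?cent_norm.
  have: S1 / 'C(D) = N / 'C(D).
    by apply: pHall_id (locG D sDG pD); apply: quotient_pHall; rewrite // (subset_trans sS1N).
  move=> eqSN; have: N \subset 'C(D) * S1.
    by rewrite -quotientSK // eqSN.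
  by move=> sN; rewrite group_modr // subsetI subxx.
have [c Cc {n Nn}def_P1]: exists2 c, c \in 'C_G(D) & P1 :=: S1 :^ c.
  have: n^-1 \in N by rewrite groupV.
  move/(subsetP sNCS)=> /mulsgP[c s Cc S1s def_n].
  exists c^-1.
    rewrite groupV; apply: subsetP Cc; rewrite setSI //; exact: subsetIl.
  rewrite def_P1 -[n]invgK def_n invMg conjsgM; congr (_ :^ _).
  by rewrite conjGid ?groupV.
have sS1G: S1 \subset G by rewrite (subset_trans sS1N) ?subsetIl.
have [R sylR sS1R] := Sylow_superset sS1G pS1.
have [c1 Cc1 def_R] : exists2 c1, c1 \in 'C_G(S :&: R) & R :=: S :^ c1.
  apply: IHm => //; apply: (ltD (S :&: R)%G).
    apply: proper_sub_trans prNS _; rewrite subsetI subsetIl.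
    exact: subset_trans sNS1 sS1R.
  by rewrite subIset // sSG.
have Gc: c \in G by case/setIP: Cc.
have sylRc: p.-Sylow(G) (R :^ c) by rewrite pHallJ.
have [c2 Cc2 def_P] : exists2 c2, c2 \in 'C_G(R :^ c :&: P) & P :=: (R :^ c) :^ c2.
  apply: (IHm (R :^ c)%G P) => //; apply: (ltD (R :^ c :&: P)%G).
    apply: proper_sub_trans prNP _; rewrite subsetI subsetIl andbT.
    by rewrite (subset_trans sNP1) // def_P1 conjSg.
  by rewrite subIset // sPG orbT.
exists (c1 * c * c2); last by rewrite def_P def_R !conjsgM.
have sDR: D \subset R.
  by rewrite (subset_trans _ sS1R) // (subset_trans _ sNS1) // proper_sub.
have sDP1: D \subset P1 by rewrite (subset_trans (proper_sub prNP)).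
have sDRc: D \subset R :^ c.
  by rewrite (subset_trans sDP1) // def_P1 conjSg.
rewrite !groupM //.
  by apply: subsetP Cc1; rewrite setIS // centS // subsetI sDS.
by apply: subsetP Cc2; rewrite setIS // centS // subsetI sDRc.
Qed.

(* The transfer G -> P / P' kills G', but maps g in P to the coset of
   g ^ #|G : P|, since its factors are conjugates of powers of g. *)
Lemma focal_subgroup_der1 G P :
    p.-Sylow(G) P ->
    (forall x g, x \in P -> g \in G -> x ^ g \in P -> [~ x, g] \in P^`(1)) ->
  P :&: G^`(1) \subset P^`(1).
Proof.
move=> sylP fusP; have [sPG pP p'GP] := and3P sylP.
have nP'P: P \subset 'N(P^`(1)) := gFnorm _ _.
pose f := restrm_morphism nP'P (coset_morphism P^`(1)).
have f_im: f @* P = P / P^`(1) by rewrite morphim_restrm setIid.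
have abf: abelian (f @* P) by rewrite f_im der_abelian.
have Vder g : g \in G^`(1) -> transfer G abf g = 0%R.
  move=> G'g; have Gg := subsetP (der_sub 1 G) _ G'g.
  pose V := transfer_morphism G abf.
  have: V g \in V @* [~: G, G] by apply: mem_morphim.
  rewrite morphimR // (commG1P _); first by move/set1P.
  by apply/centsP=> u _ v _; apply: GRing.addrC.
apply/subsetP=> g /setIP[Pg G'g].
have Gg := subsetP sPG g Pg.
have [X trX] : exists X, is_transversal X (rcosets P G :* <[g]>) G.
  exists (transversal (rcosets P G :* <[g]>) G).
  by apply: transversalP; apply: rcosets_cycle_partition.
have sXG := subsetP (transversal_sub trX).
have := transfer_cycle_expansion sPG abf Gg trX.
rewrite Vder //= => Veq.
pose n x := #|<[g]> : P :* x|.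
have fM: {in P &, {morph (FiniteModule.fmod abf \o f) : x y / (x * y)%g >-> (x + y)%R}}.
  by move=> x y Px Py; rewrite /= morphM // FiniteModule.fmodM ?mem_morphim.
have step x : x \in X ->
    restrm (transfer_morph_subproof f) (FiniteModule.fmod abf \o f) ((g ^+ n x) ^ x^-1)
    = FiniteModule.fmod abf (f (g ^+ n x)).
  move=> Xx; have expP: (g ^+ n x) ^ x^-1 \in P.
    by rewrite conjgE invgK mulgA -mem_rcoset mulg_exp_card_rcosets.
  congr (FiniteModule.fmod _ _).
  have Pgn: g ^+ n x \in P by rewrite groupX.
  have P'c: [~ g ^+ n x, x^-1] \in P^`(1).
    by apply: fusP => //; rewrite ?groupV ?sXG.
  rewrite -[_ ^ x^-1](mulKVg (g ^+ n x)) -commgEl.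
  rewrite morphM //=; last by apply: subsetP P'c; apply: der_sub.
  by rewrite /restrm (coset_id P'c) mulg1.
rewrite (eq_bigr _ step) in Veq.
have fgn: FiniteModule.fmod abf (f (g ^+ #|G : P|)) = 0%R.
  rewrite -(sum_index_rcosets_cycle sPG Gg trX) [RHS]Veq.
  elim/big_rec2: _ => [|x y z Xx <-]; first by rewrite expg0 morph1 FiniteModule.fmod1.
  by rewrite expgD -[LHS]/((FiniteModule.fmod abf \o f) _) fM ?groupX.
have Pgn : g ^+ #|G : P| \in P by rewrite groupX.
have: g ^+ #|G : P| \in P^`(1).
  apply: coset_idr; first by rewrite (subsetP nP'P).
  have: f (g ^+ #|G : P|) = 1; last by [].
  by rewrite -(FiniteModule.fmodK abf (mem_morphim f Pgn Pgn)) fgn.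
have coP: coprime #|P| #|G : P| by rewrite (pnat_coprime pP).
by move/(groupX (expg_invn P #|G : P|)); rewrite expgK.
Qed.

End Fusion.

(** Elements of a Sylow subgroup P that fuse in G already fuse in P, so P :&: G' lies in P', which
    is proper in P. Hence G has a proper normal subgroup [M] of p-power index, and induction applies
    to [M]. *)
Theorem Frobenius_pnilpotent (gT : finGroupType) (G : {group gT}) :
    (forall D : {group gT}, D \subset G -> p.-group D ->
       p.-group ('N_G(D) / 'C(D))) ->
  pnilpotent G.
Proof.
have [m] := ubnP #|G|; elim: m G => // m IHm G /ltnSE-leGm locG.
have [P sylP] := Sylow_exists p G; have [sPG pP p'GP] := and3P sylP.
have [P1 | ntP] := eqsVneq P 1.
  apply: (@normal_p'Hall_pnilpotent gT G G) => //; last by rewrite indexgg.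
  by move: p'GP; rewrite P1 indexg1.
have fusP x g : x \in P -> g \in G -> x ^ g \in P -> [~ x, g] \in P^`(1).
  move=> Px Gg Pxg.
  have sylPg: p.-Sylow(G) (P :^ g) by rewrite pHallJ.
  (* Here [c] centralises [x ^ g] and [g * c] normalises [P]. Modulo C(P) the element [g * c] agrees
     with some [u] in [P], so [x ^ g = x ^ u]. *)
  have [c /setIP[Gc Cc] def_P] := Sylow_cent_setI_trans locG sylPg sylP.
  have cxg: commute (x ^ g) c.
    by apply/esym/(centP Cc); rewrite inE Pxg memJ_conjg Px.
  have Ngc: g * c \in 'N_G(P).
    rewrite inE groupM //=; apply/normP.
    by rewrite conjsgM [RHS]def_P.
  have: coset 'C(P) (g * c) \in P / 'C(P).
    have nCN: 'N_G(P) \subset 'N('C(P)) by rewrite (subset_trans (subsetIr _ _)) ?cent_norm.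
    have sylPN: p.-Sylow('N_G(P)) P by rewrite Sylow_subnorm.
    have <-: 'N_G(P) / 'C(P) = P / 'C(P).
      apply/esym/pHall_id; last exact: (locG P).
      apply: quotient_pHall sylPN; apply: subset_trans nCN.
      by rewrite subsetI sPG normG.
    by rewrite mem_morphim // (subsetP nCN).
  case/morphimP=> u NCu Pu /= eq_u.
  have Ncgc: g * c \in 'N('C(P)) by rewrite (subsetP (cent_norm P)) //; case/setIP: Ngc.
  have: g * c * u^-1 \in 'C(P).
    by rewrite -mem_rcoset; apply/rcoset_kercosetP.
  move=> Cgcu; have eqxg: x ^ g = x ^ u.
    have ->: x ^ g = x ^ (g * c) by rewrite conjgM [RHS]conjgE cxg mulKg.
    by rewrite -[g * c](mulgKV u) conjgM [x ^ (_ * _)]conjgE -(centP Cgcu x Px) mulKg.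
  by rewrite commgEl eqxg -commgEl mem_commg.
have sP'P: P^`(1) \proper P.
  by rewrite properE der_sub proper_subn // (sol_der1_proper (pgroup_sol pP)).
have ltP := focal_subgroup_der1 sylP fusP.
pose M := (coset G^`(1) @*^-1 'O_p^'(G / G^`(1)))%G.
have nsG'G: G^`(1) <| G := der_normal 1 G.
have nsMG: M <| G by rewrite -(quotientGK nsG'G) cosetpre_normal pcore_normal.
have sG'M: G^`(1) \subset M by apply: sub_cosetpre.
have quoM: M / G^`(1) = 'O_p^'(G / G^`(1)) by rewrite cosetpreK.
have nilG: nilpotent (G / G^`(1)) by rewrite abelian_nil ?der_abelian.
have hallO := nilpotent_pcore_Hall p^' nilG.
have pGM: p.-group (G / M).
  rewrite /pgroup card_quotient ?normal_norm //.
  have <-: #|G / G^`(1) : M / G^`(1)| = #|G : M|.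
    apply: index_quotient_eq; [|exact: normal_sub|exact: normal_norm].
    by rewrite subIset // sG'M orbT.
  by rewrite quoM pnilpotent_index.
apply: (pnilpotent_of_normal nsMG pGM); have sMG := normal_sub nsMG; apply: IHm.
  (* If [M] were G, then G / G' would be a p'-group and P would lie in G', hence in P'. *)
  apply: leq_trans leGm; rewrite proper_card // properE sMG.
  apply: contra (proper_subn sP'P) => sGM; apply: subset_trans ltP.
  rewrite subsetI subxx /=.
  have nG'P: P \subset 'N(G^`(1)) by rewrite (subset_trans sPG) ?normal_norm.
  rewrite -quotient_sub1 //; have <- := TI_pcoreC p (G / G^`(1)) (G / G^`(1)).
  rewrite subsetI -quoM quotientS ?(subset_trans sPG) // andbT.
  by rewrite pcore_max ?quotient_pgroup // -sub_abelian_normal ?der_abelian ?quotientS.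
move=> D sDM pD; apply: pgroupS (locG D (subset_trans sDM sMG) pD).
by rewrite quotientS ?setSI.
Qed.

End Pnilpotent.

(** * Quadratic action in odd characteristic *)

Section Quadratic.

Import GRing.Theory.
Local Open Scope ring_scope.

Lemma expr1D_sqr0 (R : nzRingType) (F : R) n : F * F = 0 -> (1 + F) ^+ n = 1 + F *+ n.
Proof.
move=> F0; elim: n => [|n IHn]; first by rewrite expr0 mulr0n addr0.
by rewrite exprS IHn mulrDl mul1r mulrDr mulr1 mulrnAr F0 mul0rn addr0 mulrSr -addrA.
Qed.

(* With D = yN - Ny and M = NyN the two conjugates of y are y + D - M and
   y - D - M; since y commutes with both, it commutes with D and M, which
   forces D^2 = 0 and then (D - M)^2 = 0. *)
Lemma conj_unipotent_nilpotent (R : nzRingType) (y N : R) :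
    N * N = 0 -> (forall x : R, x *+ 2 = 0 -> x = 0) ->
    GRing.comm y ((1 - N) * y * (1 + N)) ->
    GRing.comm y ((1 + N) * y * (1 - N)) ->
  exists E, [/\ (1 - N) * y * (1 + N) = y + E, E * E = 0 & GRing.comm y E].
Proof.
move=> N2 reg2; pose D := y * N - N * y; pose M := N * y * N.
have -> : (1 - N) * y * (1 + N) = y + (D - M).
  rewrite mulrDr mulr1 !mulrBl mul1r /D /M -!addrA; congr (_ + _).
  by rewrite addrCA.
have -> : (1 + N) * y * (1 - N) = y - (D + M).
  rewrite mulrBr mulr1 !mulrDl mul1r /D /M !opprD opprK -!addrA; congr (_ + _).
  by rewrite addrCA; congr (_ + _).
move=> c1 c2.
have cDM: GRing.comm y (D - M).
  by move: c1; rewrite /GRing.comm mulrDr mulrDl => /addrI.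
have cDM': GRing.comm y (D + M).
  by move: c2; rewrite /GRing.comm mulrBr mulrBl => /addrI/oppr_inj.
have half x : GRing.comm y (x *+ 2) -> GRing.comm y x.
  rewrite /GRing.comm mulrnAr mulrnAl => /eqP; rewrite -subr_eq0 -mulrnBl => /eqP/reg2/eqP.
  by rewrite subr_eq0 => /eqP.
have cD: GRing.comm y D.
  apply: half; have -> : D *+ 2 = (D - M) + (D + M) by rewrite addrACA addNr addr0 mulr2n.
  exact: commrD.
have cM: GRing.comm y M.
  by have -> : M = (D + M) - D by [rewrite addrC addKr]; apply: commrB.
have ND: N * D = M by rewrite /D mulrBr !mulrA N2 mul0r subr0.
have DN: D * N = - M by rewrite /D mulrBl -mulrA N2 mulr0 sub0r.
have MM: M * M = 0 by rewrite /M -!mulrA [N * (N * _)]mulrA N2 mul0r !mulr0.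
have DD: D * D = 0.
  rewrite {2}/D mulrBr !mulrA DN -cD -mulrA DN mulrN mulNr -cM opprK.
  by rewrite addNr.
have DM: D * M = - (M * D) by rewrite -{1}ND mulrA DN mulNr.
exists (D - M); split=> //.
by rewrite (mulrBl _ D M) (mulrBr D D M) (mulrBr M D M) DD MM DM sub0r opprK subr0 subrr.
Qed.

End Quadratic.

Section QuadraticAction.

Import GRing.Theory.

Variables (gT : finGroupType) (p : nat).
Implicit Types W Q : {group gT}.

(** Over F_p the element b acts on W as 1 + N with N^2 = 0, and b^-1 as 1 - N; p odd excludes
    2-torsion. By [conj_unipotent_nilpotent] the commutator [y, b] acts as 1 + F with F^2 = 0, so
    its p-th power acts trivially. Since [y, b] lies in the p'-group Q, it acts trivially itself. *)
Lemma quadratic_abelian_cent W Q b :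
    odd p -> p.-abelem W -> abelian Q -> p^'.-group Q -> Q \subset 'N(W) ->
    b \in 'N(Q) -> b \in 'N(W) ->
    (forall w, w \in W -> [~ w, b, b] = 1) ->
  forall y, y \in Q -> [~ y, b] \in 'C(W).
Proof.
move=> odd_p abelW abQ p'Q nWQ nQb nWb quadb y Qy.
have [-> | ntW] := eqsVneq W 1; first by rewrite cent1T inE.
have [p_pr _ _] := pgroup_pdiv (abelem_pgroup abelW) ntW.
pose G := (<[b]> <*> Q)%G.
have nWG: G \subset 'N(W) by rewrite join_subG cycle_subG nWb.
have sQG: Q \subset G by apply: joing_subr.
have Gb: b \in G by rewrite mem_gen // inE cycle_id.
have Gy: y \in G := subsetP sQG y Qy.
pose rG := abelem_repr abelW ntW nWG.
pose N := (rG b - 1)%R.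
have defb: rG b = (1 + N)%R by rewrite /N GRing.addrC GRing.subrK.
pose rV := rVabelem abelW ntW.
have rVW v : rV v \in W by apply: mem_rVabelem.
have rVN v : rV (v *m N)%R = [~ rV v, b].
  rewrite mulmxBr mulmx1 [rV _]rVabelemD rVabelemN rVabelemJ // commgEl.
  by rewrite (centsP (abelem_abelian abelW)) ?groupV ?memJ_norm ?rVW.
have N2: (N * N = 0)%R.
  apply/row_matrixP=> i; rewrite rowE row0 -mulmxE mulmxA.
  by apply: (@rVabelem_inj _ _ _ abelW ntW); rewrite rVabelem0 -/rV !rVN quadb.
have charp: p \in [pchar 'F_p]%R by apply: pchar_Fp.
have reg2 (x : 'M['F_p]_('dim W)) : (x *+ 2 = 0 -> x = 0)%R.
  move/eqP; rewrite -scaler_nat scaler_eq0 -(dvdn_pcharf charp) => /orP[|/eqP//].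
  rewrite dvdn_prime2 // => /eqP p2; by rewrite p2 in odd_p.
have defbV: rG b^-1 = (1 - N)%R.
  rewrite repr_mxV //; apply: (mulrI (repr_mx_unit rG Gb)).
  rewrite -mulmxE mulmxV ?repr_mx_unit // mulmxE defb.
  by rewrite GRing.mulrBr GRing.mulr1 GRing.mulrDl N2 GRing.mul1r GRing.addr0 GRing.addrK.
have rM x z : x \in G -> z \in G -> rG (x * z)%g = (rG x * rG z)%R by apply: repr_mxM.
have rC x z : x \in Q -> z \in Q -> GRing.comm (rG x) (rG z).
  move=> Qx Qz; rewrite /GRing.comm -!rM ?(subsetP sQG) //.
  by rewrite (centsP abQ).
have rJ : rG (y ^ b) = ((1 - N) * rG y * (1 + N))%R.
  by rewrite conjgE mulgA !rM ?groupM ?groupV // defb defbV.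
have rJV : rG (y ^ b^-1) = ((1 + N) * rG y * (1 - N))%R.
  by rewrite conjgE invgK mulgA !rM ?groupM ?groupV // defb defbV.
have Qyb : y ^ b \in Q by rewrite memJ_norm.
have [E [defyb E2 cE]]: exists E, [/\ (1 - N) * rG y * (1 + N) = rG y + E,
    E * E = 0 & GRing.comm (rG y) E]%R.
  apply: conj_unipotent_nilpotent N2 reg2 _ _.
    by rewrite -rJ; apply: rC.
  by rewrite -rJV; apply: rC; rewrite ?memJ_norm ?groupV.
have Qc : [~ y, b] \in Q by rewrite commgEl groupM ?groupV.
pose F := (rG (y^-1)%g * E)%R.
have cEV: GRing.comm (rG (y^-1)%g) E.
  by rewrite repr_mxV //; apply/GRing.commr_sym/GRing.commrV/GRing.commr_sym.
have F2: (F * F = 0)%R.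
  by rewrite /F -GRing.mulrA [(E * _)%R]GRing.mulrA -cEV -!GRing.mulrA E2 !GRing.mulr0.
have rc : rG [~ y, b] = (1 + F)%R.
  rewrite commgEl rM ?groupV ?(subsetP sQG _ Qyb) // rJ defyb GRing.mulrDr; congr (_ + _)%R.
  by rewrite -rM ?groupV // mulVg repr_mx1.
have rcp : rG ([~ y, b] ^+ p) = 1%R.
  rewrite repr_mxX ?(subsetP sQG) // rc expr1D_sqr0 // -scaler_nat pcharf0 //.
  by rewrite scale0r addr0.
have: [~ y, b] ^+ p \in 'C_G(W).
  by rewrite -(rker_abelem abelW ntW nWG); apply/rkerP; rewrite groupX ?(subsetP sQG).
case/setIP=> _ /(groupX (expg_invn Q p)); rewrite expgK //.
by rewrite coprime_sym prime_coprime // -p'natE.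
Qed.

End QuadraticAction.

(** * Coprime action and offenders *)

Section CoprimeAction.

Variable gT : finGroupType.
Implicit Types A B C Q U V W Z : {group gT}.

Lemma pgroup_cent_nontrivial (p : nat) A V :
  p.-group A -> p.-group V -> A \subset 'N(V) -> V :!=: 1 -> 'C_V(A) != 1.
Proof.
move=> pA pV nVA ntV; have pG: p.-group (V <*> A).
  by rewrite norm_joinEr // pgroupM pV.
have nsV: V <| V <*> A by rewrite normalYl.
have := meet_center_nil (pgroup_nil pG) nsV ntV; apply: contraNneq => C1.
rewrite -subG1 -C1 setIS // subIset // orbC.
by rewrite centY subsetIr.
Qed.

(* Thompson's A x B lemma. *)
Lemma cent_sub_cent_p'group (p : nat) W A Q :
    p.-group W -> abelian W -> p.-group A -> p^'.-group Q ->
    A \subset 'N(W) -> Q \subset 'N(W) -> A \subset 'C(Q) ->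
  'C_W(A) \subset 'C(Q) -> Q \subset 'C(W).
Proof.
move=> pW abW pA p'Q nWA nWQ cQA sCC.
have coWQ: coprime #|W| #|Q| by apply: pnat_coprime pW p'Q.
apply/commG1P/eqP; rewrite commGC; apply/idPn=> ntV.
have sVW: [~: W, Q] \subset W by rewrite commg_subl.
have nVA: A \subset 'N([~: W, Q]) by rewrite normsR // cents_norm.
(* A nontrivial [W, Q] would contain a nontrivial fixed point of A. By hypothesis Q centralises it,
   but coprime action gives [W, Q] :&: C_W(Q) = 1. *)
case/eqP: (pgroup_cent_nontrivial pA (pgroupS sVW pW) nVA ntV).
apply/trivgP; rewrite /= -(coprime_abel_cent_TI nWQ coWQ abW).
by rewrite subsetI subsetIl /= (subset_trans _ sCC) ?setSI.
Qed.

Section Norm.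

Import FiniteModule GRing.Theory.
Local Open Scope ring_scope.

(** The sum is invariant under b, since b only permutes its terms cyclically, and 'C_Q[b] is
    trivial. *)
Lemma sum_cycle_eq0 Q (abQ : abelian Q) b n (u : fmod_of abQ) :
    b \in 'N(Q) -> (b ^+ n = 1)%g -> 'C_Q[b]%g = 1%g ->
  \sum_(i < n) u ^@ (b ^+ i)%g = 0.
Proof.
move=> nQb bn C1; set v := \sum_(i < n) _.
have vb: v ^@ b = v.
  rewrite /v actr_sum; case: n bn {v} => [|n] bn; first by rewrite !big_ord0.
  rewrite big_ord_recr [in RHS]big_ord_recl /= addrC -actrM ?groupX // -expgSr bn.
  by congr (_ + _); apply: eq_bigr => i _; rewrite -actrM ?groupX // -expgSr.
apply: fmod_inj; apply/eqP; rewrite -in_set1 -[[set _]]C1 inE fmodP.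
by apply/cent1P/commgP/conjg_fixP; rewrite -fmvalJ // vb.
Qed.

(* For u in Q, the sum over i, j < p of u ^@ ((b1^i b2)^j) vanishes row by
   row, and so do its columns j > 0; the column j = 0 is u *+ p. *)
Lemma abelem_semiregular_index p B C Q :
    prime p -> p.-abelem B -> B \subset 'N(Q) -> abelian Q -> p^'.-group Q ->
    C \subset B -> (forall b, b \in B :\: C -> 'C_Q[b] = 1)%g ->
  (p < #|B : C|)%N -> Q :=: 1%g.
Proof.
move=> p_pr abelB nQB abQ p'Q sCB semiB ltpi.
have [pB abB _] := and3P abelB.
have Bp b : b \in B -> (b ^+ p = 1)%g by case/(abelemP p_pr): abelB => _; apply.
have norm0 u b : b \in B :\: C -> \sum_(i < p) (u : fmod_of abQ) ^@ (b ^+ i)%g = 0.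
  move=> BCb; have /setDP[Bb _] := BCb.
  by apply: sum_cycle_eq0; rewrite ?semiB ?Bp ?(subsetP nQB).
have [b1 Bb1 nCb1]: exists2 b1, b1 \in B & b1 \notin C.
  apply/subsetPn; apply: contraL ltpi => sBC; rewrite -leqNgt.
  have /eqP eqBC: B :==: C by rewrite eqEsubset sBC.
  by rewrite eqBC indexgg prime_gt0.
have nCb1': b1 \in 'N(C) by rewrite (subsetP _ _ Bb1) // sub_abelian_norm.
pose C1 := (C <*> <[b1]>)%G.
have defC1: C1 :=: (C * <[b1]>)%g by rewrite /= joingC norm_joinEl ?cycle_subG // normC ?cycle_subG.
have sC1B: C1 \subset B by rewrite join_subG sCB cycle_subG.
(* As b1 has order dividing p, |C1| is at most p |C|, which is less than |B|. *)
have [b2 Bb2 nCb2]: exists2 b2, b2 \in B & b2 \notin C1.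
  apply/subsetPn; apply: contraL ltpi => sBC1; rewrite -leqNgt.
  have /eqP eqB: C1 :==: B by rewrite eqEsubset sC1B.
  rewrite -(leq_pmul2l (cardG_gt0 C)) Lagrange // -eqB defC1.
  rewrite (leq_trans (leq_pmulr _ (cardG_gt0 (C :&: <[b1]>)))) // -mul_cardG.
  by rewrite leq_mul // dvdn_leq ?prime_gt0 // order_dvdn Bp.
have BCi i : (b1 ^+ i * b2)%g \in B :\: C.
  rewrite inE [_ \in B]groupM ?groupX // andbT; apply: contra nCb2 => Ci.
  rewrite -(groupMl _ (_ : b1 ^+ i \in C1)%g) ?groupX //; last first.
    by rewrite mem_gen // inE cycle_id orbT.
  by apply: subsetP Ci; apply: joing_subl.
have BCj (j : 'I_p) : j != 0%N :> nat -> (b1 ^+ j)%g \in B :\: C.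
  move=> j0; rewrite inE [_ \in B]groupX // andbT; apply: contra nCb1 => Cj.
  have cop: coprime p j by rewrite prime_coprime // gtnNdvd // lt0n.
  have co1: coprime #[b1] j.
    by rewrite (coprime_dvdl _ cop) // order_dvdn Bp.
  by rewrite -(expgK co1 (cycle_id b1)) groupX.
have nQ b : b \in B -> b \in 'N(Q) by apply: subsetP.
apply/trivgP/subsetP=> x Qx; rewrite inE.
pose u := fmod abQ x.
have: \sum_(i < p) \sum_(j < p) u ^@ ((b1 ^+ i * b2) ^+ j)%g = 0.
  by rewrite big1 // => i _; apply: norm0.
rewrite exchange_big /=.
rewrite (bigD1 (Ordinal (prime_gt0 p_pr))) //= [X in _ + X]big1 ?addr0.
  rewrite (eq_bigr (fun=> u)); last by move=> i _; rewrite expg0 actr1.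
  rewrite sumr_const card_ord => up; apply/eqP.
  have xp: (x ^+ p = 1)%g by rewrite -[x](fmodK abQ) // -fmvalZ up.
  have coQp: coprime #|Q| p by rewrite coprime_sym prime_coprime // -p'natE.
  by rewrite -(expgK coQp Qx) xp expg1n.
move=> j j0; have Bj : (b1 ^+ j)%g \in B :\: C by apply: BCj.
rewrite (eq_bigr (fun i : 'I_p => u ^@ (b2 ^+ j)%g ^@ ((b1 ^+ j) ^+ i)%g)); first exact: norm0.
move=> i _; rewrite -actrM ?nQ ?groupX // expgMn; last by apply: (centsP abB); rewrite ?groupX.
by rewrite (centsP abB (_ ^+ j)%g) ?groupX // -!expgM mulnC.
Qed.

(* C is chosen maximal such that B does not centralise C_Q(C); the elements of
   B outside C then act without fixed points on [C_Q(C), B]. *)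
Lemma abelem_maximal_noncentral p B Q :
    prime p -> p.-abelem B -> B \subset 'N(Q) -> abelian Q -> p^'.-group Q ->
    ~~ (B \subset 'C(Q)) ->
  exists C : {group gT}, [/\ C \subset B, #|B : C| = p & ~~ (B \subset 'C('C_Q(C)))].
Proof.
move=> p_pr abelB nQB abQ p'Q ncBQ; have [pB abB _] := and3P abelB.
pose P C := (C \subset B) && ~~ (B \subset 'C('C_Q(C))).
have P1: P [1 gT]%G by rewrite /P sub1G cent1T setIT.
have [C maxC _] := maxgroup_exists P1.
have [/andP[sCB nc] maxP] := maxgroupP maxC.
exists C; split=> //.
have abQ1: abelian 'C_Q(C) := abelianS (subsetIl _ _) abQ.
have nQ1B: B \subset 'N('C_Q(C)).
  by rewrite normsI // norms_cent // sub_abelian_norm.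
have p'Q1: p^'.-group 'C_Q(C) := pgroupS (subsetIl _ _) p'Q.
have coQ1B: coprime #|'C_Q(C)| #|B| by rewrite coprime_sym (pnat_coprime pB).
have sQ2: [~: 'C_Q(C), B] \subset 'C_Q(C) by rewrite commg_subl.
have neCB: C != B :> {set gT}.
  apply: contraNneq nc => ->; rewrite centsC subsetIr //.
have piBC: p.-nat #|B : C| by rewrite (pnat_dvd (dvdn_indexg _ _)).
have [k def_k] := p_natP piBC.
case: k => [|[|k]] in def_k; rewrite ?def_k //.
  by case/negP: neCB; rewrite eqEsubset sCB -indexg_eq1 def_k.
(* The index is now at least p^2, so [abelem_semiregular_index] kills [C_Q(C), B]. *)
case/negP: nc; rewrite centsC; apply/commG1P.
apply: (@abelem_semiregular_index p B C [~: 'C_Q(C), B]%G) => //.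
- by rewrite normsR ?normG.
- exact: abelianS sQ2 abQ1.
- exact: pgroupS sQ2 p'Q1.
- move=> b /setDP[Bb nCb]; apply/trivgP.
  rewrite -(coprime_abel_cent_TI nQ1B coQ1B abQ1) subsetI subsetIl /=.
  pose D := (C <*> <[b]>)%G.
  have sDB: D \subset B by rewrite join_subG sCB cycle_subG.
  have: B \subset 'C('C_Q(D)).
    apply/idPn=> ncD; case/negP: nCb; rewrite -(maxP D) ?joing_subl //; last by rewrite /P sDB.
    by rewrite mem_gen // inE cycle_id orbT.
  rewrite centsC; apply: subset_trans.
  by rewrite /= centY cent_cycle setIA setSI.
by have := ltn_exp2l 1 k.+2 (prime_gt1 p_pr); rewrite def_k expn1.
Qed.

End Norm.

End CoprimeAction.

(** * Offenders and quadratic action *)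

Section Offender.

Variable gT : finGroupType.
Implicit Types A B C Q U V W Z : {group gT}.

(** [abelem_maximal_noncentral] for B / Z acting on Q / Z. Since Q meets Z trivially and commutes
    with it, centralisers in Q are carried faithfully to the quotient. *)
Lemma exists_maximal_noncentral p B Q Z :
    prime p -> p.-group B -> B \subset 'N(Q) -> abelian Q -> p^'.-group Q ->
    Z <| B -> p.-abelem (B / Z) -> Z \subset 'C(Q) -> ~~ (B \subset 'C(Q)) ->
  exists C : {group gT},
    [/\ Z \subset C, C \subset B, #|B : C| = p & ~~ (B \subset 'C('C_Q(C)))].
Proof.
move=> p_pr pB nQB abQ p'Q nsZB abelBZ cQZ ncBQ; have [sZB nZB] := andP nsZB.
have nZQ: Q \subset 'N(Z) by rewrite cents_norm // centsC.
have tiQZ: Q :&: Z = 1.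
  by rewrite setIC coprime_TIg // (pnat_coprime (pgroupS sZB pB)).
have quoC C : C \subset B -> 'C_Q(C) / Z = 'C_(Q / Z)(C / Z).
  move=> sCB; apply: quotient_TI_subcent => //; exact: subset_trans sCB _.
have [||||Cb [sCbB piCb nc]] := @abelem_maximal_noncentral _ p (B / Z)%G (Q / Z)%G p_pr abelBZ.
- exact: quotient_norms.
- exact: quotient_abelian.
- exact: quotient_pgroup.
- apply: contra ncBQ; rewrite centsC quotient_cents2 // => sZ.
  rewrite centsC; apply/commG1P/trivgP; rewrite -tiQZ subsetI sZ andbT.
  by rewrite commg_subl.
have [C defCb sZC sCB] := inv_quotientS nsZB sCbB.
exists C; split=> //.
  rewrite -piCb defCb index_quotient_eq //.
  by rewrite subIset // sZC orbT.
by apply: contra nc => cC; rewrite defCb -quoC // quotient_cents.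
Qed.

(** U / C_U[b] has order 1 or p, so the p-element b acts trivially on it; this says that [w, b] lies
    in C_U[b]. *)
Lemma quadratic_index_le p U b :
    prime p -> p.-group U -> abelian U -> p.-elt b -> b \in 'N(U) ->
    (#|U| <= p * #|'C_U[b]|)%N ->
  forall w, w \in U -> [~ w, b, b] = 1.
Proof.
move=> p_pr pU abU pb nUb leU w Uw; apply/eqP/commgP/cent1P.
suff: [~ w, b] \in 'C_U[b] by case/setIP.
pose U1 := 'C_U[b]%G; have sU1U: U1 \subset U := subsetIl _ _.
have nU1U: U \subset 'N(U1) := sub_abelian_norm abU sU1U.
have nUb': <[b]> \subset 'N(U) by rewrite cycle_subG.
have nU1b: <[b]> \subset 'N(U1).
  by rewrite normsI // cents_norm // centsC cent_cycle.
have [/eqP | ntU] := eqVneq (U / U1) 1.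
  rewrite -subG1 quotient_sub1 // => /subsetP/(_ w Uw)/setIP[_ /cent1P/commgP/eqP->].
  exact: group1.
have prU: #|U / U1| = p.
  have [_ _ [k def_k]] := pgroup_pdiv (quotient_pgroup U1 pU) ntU.
  have: #|U / U1| <= p.
    by rewrite card_quotient // -divgS // leq_divLR ?cardSg.
  have := leq_exp2l k.+1 1 (prime_gt1 p_pr); rewrite def_k expn1 => -> /ltnSE.
  by rewrite leqn0 => /eqP->; rewrite expn1.
have: 'C_(U / U1)(<[b]> / U1) != 1.
  by apply: (@pgroup_cent_nontrivial _ p) => //=; rewrite ?quotient_pgroup ?quotient_norms.
have prime_U : prime #|U / U1| by rewrite prU.
case: (prime_subgroupVti ('C(<[b]> / U1)) prime_U) => [cU _ | ]; last first.
  by rewrite setIC => ->; rewrite eqxx.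
move: cU; rewrite quotient_cents2 // => /subsetP; apply.
by rewrite mem_commg ?cycle_id.
Qed.

(* A subgroup A of B containing Z and maximising |A||C_W(A)| has a hyperplane C
   such that C_W(A) has index at most p in U = C_W(C); hence A acts quadratically
   on U, and [C_Q(C), A] centralises U, so also W by the A x B lemma. *)
Lemma offender_bound p W Q B Z :
    prime p -> odd p -> p.-abelem W -> abelian Q -> p^'.-group Q ->
    p.-group B -> Z <| B -> p.-abelem (B / Z) ->
    B \subset 'N(Q) -> B \subset 'N(W) -> Q \subset 'N(W) ->
    Z \subset 'C(Q) -> Z \subset 'C(W) -> 'C_B(Q) \subset Z -> 'C_Q(W) = 1 ->
    ~~ (B \subset Z) ->
  (#|B| * #|'C_W(B)| < #|Z| * #|W|)%N.
Proof.
move=> p_pr odd_p abelW abQ p'Q pB nsZB abelBZ nQB nWB nWQ cQZ cWZ sCBZ CQW1 nsBZ.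
have [sZB nZB] := andP nsZB; rewrite ltnNge; apply/negP=> le_m.
pose m (A : {group gT}) := (#|A| * #|'C_W(A)|)%N.
have [pW abW _] := and3P abelW.
have mZ : m Z = (#|Z| * #|W|)%N by rewrite /m (setIidPl _) // centsC.
pose P (A : {group gT}) := [&& Z \subset A, A \subset B & ~~ (A \subset Z)].
have PB : P B by rewrite /P sZB subxx.
have [A /and3P[sZA sAB nsAZ] maxA] := @arg_maxnP _ B P m PB.
(* Subgroups inside [Z] were excluded from the maximisation, but [Z] obeys the same bound: the
   negated conclusion says [m Z <= m B]. *)
have lemA C : Z \subset C -> C \subset B -> m C <= m A.
  move=> sZC sCB; have [sCZ | nsCZ] := boolP (C \subset Z).
    have -> : m C = m Z by congr (m _); apply/val_inj/eqP; rewrite eqEsubset sCZ.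
    by rewrite mZ (leq_trans le_m) //; apply: (maxA B).
  by apply: maxA; rewrite /P sZC sCB.
have pA := pgroupS sAB pB; have nQA := subset_trans sAB nQB.
have nWA := subset_trans sAB nWB.
have nsZA : Z <| A by rewrite /normal sZA (subset_trans sAB).
have abelAZ : p.-abelem (A / Z) := abelemS (quotientS _ sAB) abelBZ.
have ncAQ : ~~ (A \subset 'C(Q)).
  apply: contra nsAZ => cAQ; apply: subset_trans sCBZ.
  by rewrite subsetI sAB.
have [C [sZC sCA piC nc]] := exists_maximal_noncentral p_pr pA nQA abQ p'Q nsZA abelAZ cQZ ncAQ.
have nCA : A \subset 'N(C).
  rewrite -(quotientGK (normalS sZC sCA nsZA)) -(quotientGK nsZA) morphpre_norms //.
  rewrite sub_abelian_norm ?quotientS //; exact: abelem_abelian abelAZ.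
have nCNA : A \subset 'N('C(C)) by rewrite norms_cent.
pose Q1 := 'C_Q(C)%G; pose U := 'C_W(C)%G.
have nQ1A : A \subset 'N(Q1) by rewrite normsI.
have nUA : A \subset 'N(U) by rewrite normsI.
have abelU : p.-abelem U := abelemS (subsetIl _ _) abelW.
have abQ1 : abelian Q1 := abelianS (subsetIl _ _) abQ.
have p'Q1 : p^'.-group Q1 := pgroupS (subsetIl _ _) p'Q.
have nUQ1 : Q1 \subset 'N(U).
  apply: normsI; first exact: subset_trans (subsetIl _ _) nWQ.
  exact: subset_trans (subsetIr _ _) (normG _).
(* This is [m C <= m A] divided by |C|, since |A : C| = p. *)
have leU : #|U| <= (p * #|'C_W(A)|)%N.
  rewrite -(leq_pmul2l (cardG_gt0 C)) mulnA -piC Lagrange //.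
  exact: lemA (subset_trans sCA sAB).
have quad b : b \in A -> b \notin C -> forall w, w \in U -> [~ w, b, b] = 1.
  move=> Ab nCb; have pb: p.-group <[b]> by rewrite (pgroupS _ pA) ?cycle_subG.
  apply: (quadratic_index_le p_pr) => //.
  - exact: abelem_pgroup abelU.
  - exact: abelem_abelian abelU.
  - exact: (subsetP nUA).
  apply: leq_trans leU _; rewrite leq_mul2l subset_leq_card ?orbT //.
  by rewrite -setIA setIS // subsetI centS //= -cent_cycle centS // cycle_subG.
have Q0U : [~: Q1, A] \subset 'C(U).
  rewrite gen_subG; apply/subsetP=> _ /imset2P[y b Qy Ab ->].
  have [Cb | nCb] := boolP (b \in C).
    have /commgP/eqP-> : commute y b.
      by case/setIP: Qy => _ /centP/(_ b Cb)/esym.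
    exact: group1.
  apply: (quadratic_abelian_cent odd_p abelU abQ1 p'Q1 nUQ1) Qy.
  - exact: (subsetP nQ1A).
  - exact: (subsetP nUA).
  exact: quad.
have sQ0 : [~: Q1, A] \subset Q1 by rewrite commg_subl.
have sQ0Q : [~: Q1, A] \subset Q := subset_trans sQ0 (subsetIl _ _).
case/negP: nc; rewrite centsC; apply/commG1P/trivgP.
rewrite -CQW1 subsetI sQ0Q /=.
apply: (@cent_sub_cent_p'group _ p W C [~: Q1, A]%G) => //.
- exact: pgroupS pA.
- exact: pgroupS sQ0 p'Q1.
- exact: subset_trans nWA.
- exact: subset_trans nWQ.
- by rewrite centsC (subset_trans sQ0) ?subsetIr.
by rewrite centsC.
Qed.

End Offender.

(** * Thompson's normal p-complement theorem *)

Section MaximalRank.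

Variables (gT : finGroupType) (p : nat).
Implicit Types E P X : {group gT}.

(* Elementary abelian version of the Thompson subgroup. *)
Definition ThompsonJ (P : {set gT}) := <<\bigcup_(E in 'E_p^('r_p(P))(P)) gval E>>.
Canonical ThompsonJ_group P := Eval hnf in [group of ThompsonJ P].

Lemma ThompsonJ_char P : ThompsonJ P \char P.
Proof.
have sJP: ThompsonJ P \subset P.
  by rewrite gen_subG; apply/bigcupsP=> E /pnElemP[].
apply/charP; split=> // f injf fP.
apply/eqP; rewrite eqEcard card_injm // leqnn andbT.
rewrite sub_morphim_pre // gen_subG; apply/bigcupsP=> E EP.
have sEP: E \subset P by case/pnElemP: EP.
rewrite -sub_morphim_pre //; apply: sub_gen.
apply: (bigcup_sup (f @* E)%G) => //=.
by have := injm_pnElem injf (subxx P) p 'r_p(P) sEP; rewrite EP {1}fP.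
Qed.

(** Every elementary abelian subgroup of P of maximal rank lies in X, so X has the same rank and the
    same such subgroups. Thus J(P) is characteristic in X as well. *)
Lemma ThompsonJ_sub_eq P X : X \subset P -> ThompsonJ P \subset X -> ThompsonJ X = ThompsonJ P.
Proof.
move=> sXP sJX.
have sEX E : E \in 'E_p^('r_p(P))(P) -> E \subset X.
  by move=> EP; apply: subset_trans sJX; apply: sub_gen; apply: bigcup_sup EP.
have [E0 EP0] := p_rank_witness p P.
have EX E : E \in 'E_p^('r_p(P))(P) -> E \in 'E_p^('r_p(P))(X).
  move=> EP; have sEX' := sEX E EP; case/pnElemP: EP => _ abE rE.
  exact/pnElemP.
have eqr : 'r_p(X) = 'r_p(P).
  apply/eqP; rewrite eqn_leq p_rankS //=.
  by apply/p_rank_geP; exists E0; apply: EX.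
congr <<_>>; apply: eq_bigl => E; rewrite eqr; apply/idP/idP; last exact: EX.
by apply: subsetP; apply: pnElemS.
Qed.

Lemma ThompsonJ_nontrivial P : p.-group P -> P :!=: 1 -> ThompsonJ P != 1.
Proof.
move=> pP ntP; have [p_pr pdvP _] := pgroup_pdiv pP ntP.
have [E EP] := p_rank_witness p P; have [_ _ rE] := pnElemP EP.
apply: contraTneq pdvP => J1.
have: E :=: 1.
  by apply/trivgP; rewrite -J1; apply: sub_gen; apply: bigcup_sup EP.
move=> E1; have := p_rank_gt0 p P; rewrite -rE E1 cards1 logn1 mem_primes p_pr cardG_gt0 /=.
by move/esym/negbT.
Qed.

End MaximalRank.

Section PcomplementLemmas.

Variable p : nat.

Lemma pnilpotent_quotient (gT : finGroupType) (G X : {group gT}) :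
  G \subset 'N(X) -> pnilpotent p G -> pnilpotent p (G / X).
Proof.
move=> nXG pG.
apply: (@normal_p'Hall_pnilpotent p _ _ ('O_p^'(G) / X)%G).
- by rewrite quotient_normal ?pcore_normal.
- by rewrite quotient_pgroup ?pcore_pgroup.
by apply: pnat_dvd (pnilpotent_index pG); rewrite index_quotient // subIset ?nXG.
Qed.

Lemma pgroup_pnilpotent (gT : finGroupType) (G : {group gT}) : p.-group G -> pnilpotent p G.
Proof.
move=> pG; apply: (@normal_p'Hall_pnilpotent p _ G 1%G); first exact: normal1.
  exact: pgroup1.
by rewrite indexg1.
Qed.

(** Frattini argument: if x normalises Y modulo M, then Y and its conjugate by x are Sylow
    p-subgroups of M Y, hence conjugate under M, and x can be corrected by an element of M. *)
Lemma norm_quotient_p'group (gT : finGroupType) (G M Y : {group gT}) :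
    M <| G -> p^'.-group M -> Y \subset G -> p.-group Y ->
  'N_(G / M)(Y / M) \subset 'N_G(Y) / M.
Proof.
move=> nsMG p'M sYG pY; have [sMG nMG] := andP nsMG.
have nMY := subset_trans sYG nMG.
have pY': p.-Sylow(M <*> Y) Y.
  have defMY: M * Y = M <*> Y by rewrite norm_joinEr.
  by case: (coprime_mulGp_Hall defMY p'M pY).
apply/subsetP=> _ /setIP[/morphimP[x Nx Gx ->]] /normP nYx.
have sYx: Y :^ x \subset M <*> Y.
  rewrite norm_joinEr // -quotientSK; last by rewrite -(normsP nMG x Gx) normJ conjSg.
  by rewrite quotientJ // [_ :^ _]nYx.
have sylYx: p.-Sylow(M <*> Y) (Y :^ x).
  by rewrite pHallE sYx cardJg -(card_Hall pY') eqxx.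
have [k MYk eqYk] := Sylow_trans pY' sylYx.
have [k' Yk' {}eqYk]: exists2 k', k' \in M & Y :^ x = Y :^ k'.
  move: MYk; rewrite /= joingC norm_joinEl // => /mulsgP[y m Yy Mm def_k].
  by exists m; rewrite // [LHS]eqYk def_k conjsgM (conjGid Yy).
have Nk' : k' \in 'N(M) by rewrite (subsetP (normG M)).
have -> : coset_morphism M x = coset_morphism M (x * k'^-1).
  by rewrite morphM ?groupV //= (coset_id (groupVr Yk')) mulg1.
apply: mem_morphim; first by rewrite groupM ?groupV.
have Gk' := subsetP sMG k' Yk'; rewrite inE groupM ?groupV //=.
by apply/normP; rewrite conjsgM [Y :^ x]eqYk conjsgK.
Qed.

Lemma charJ (gT : finGroupType) (Y P : {group gT}) x : Y \char P -> Y :^ x \char P :^ x.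
Proof.
move=> chY; have sYP := char_sub chY.
have := injm_char (injm_conj P x) (subxx P) chY.
by rewrite !morphim_conj setIid (setIidPr sYP).
Qed.

End PcomplementLemmas.

(** * The configuration of a minimal counterexample *)

Section MinimalCounterexample.

Variables (gT : finGroupType) (p q : nat) (G P X K : {group gT}).
Hypotheses (p_pr : prime p) (odd_p : odd p) (neqp : q != p).
Hypotheses (sylP : p.-Sylow(G) P) (pX : p.-group X) (nsXG : X <| G) (nsKG : K <| G).
Hypotheses (sXK : X \subset K) (qKX : q.-group (K / X)) (defG : K * P = G).
Hypothesis (Op'G1 : 'O_p^'(G) = 1).
Hypothesis over_X : forall Y : {group gT}, Y \subset G -> p.-group Y ->
  X \proper Y -> P \subset 'N(Y) -> pnilpotent p 'N_G(Y).
Hypothesis char_P : forall Y : {group gT},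
  Y \char P -> Y :!=: 1 -> pnilpotent p 'N_G(Y).
Hypothesis over_P : forall L : {group gT},
  P \subset L -> L \proper G -> pnilpotent p L.
Hypothesis not_pnilG : ~~ pnilpotent p G.

Let sPG := pHall_sub sylP.
Let pP := pHall_pgroup sylP.
Let sKG := normal_sub nsKG.
Let nKG := normal_norm nsKG.
Let sXG := normal_sub nsXG.
Let nXG := normal_norm nsXG.

Let sXP : X \subset P.
Proof.
have [x Gx sXPx] := Sylow_subJ sylP sXG pX.
by rewrite -(conjSg _ _ x) (normsP nXG x Gx).
Qed.

Let pcoreX : 'O_p(G) = X.
Proof.
apply/eqP; rewrite eq_sym eqEproper pcore_max //=; apply: contra not_pnilG => prX.
have := @over_X 'O_p(G) (pcore_sub _ _) (pcore_pgroup _ _) prX.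
by rewrite (setIidPl (gFnorm _ _)) (subset_trans sPG (gFnorm _ _)); apply.
Qed.

Let no_normal (Y : {group gT}) : Y \char P -> Y :!=: 1 -> ~~ (G \subset 'N(Y)).
Proof.
move=> chY ntY; apply: contra not_pnilG => nYG.
by have := char_P chY ntY; rewrite (setIidPl nYG).
Qed.

(** Y = C_K(X) is nilpotent, because Y :&: X is central in it with a q-group as quotient; its
    p'-core is normal in G, hence trivial. As G / K is a p-group too, C_G(X) is a normal p-subgroup
    and lies in O_p(G) = X. *)
Let cGX : 'C_G(X) \subset X.
Proof.
have nsCG: 'C_G(X) <| G by rewrite /normal subsetIl normsI ?norms_cent ?normG.
pose Y := ('C_G(X) :&: K)%G; have nsYG: Y <| G := normalI nsCG nsKG.
have sYK: Y \subset K := subsetIr _ _.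
have sXYZ: Y :&: X \subset 'Z(Y).
  rewrite subsetI subsetIl centsC (subset_trans _ (centS (subsetIr _ _))) //.
  by rewrite subIset // subsetIr.
have nilY: nilpotent Y.
  rewrite -quotient_center_nil (@pgroup_nil _ q) // /pgroup card_quotient ?gFnorm //.
  apply: pnat_dvd (indexgS _ sXYZ) _; rewrite indexgI -card_quotient.
    exact: pgroupS (quotientS X sYK) qKX.
  exact: subset_trans (normal_sub nsYG) nXG.
have pY: p.-group Y.
  have /dprodP[_ <- _ _] := nilpotent_pcoreC p nilY.
  rewrite (_ : 'O_p^'(Y) = 1) ?mulg1 ?pcore_pgroup //.
  by apply/trivgP; rewrite -Op'G1 pcore_max ?pcore_pgroup ?gFnormal_trans.
apply: (@subset_trans _ _ 'O_p(G)); last by rewrite pcoreX.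
apply: pcore_max nsCG.
rewrite /pgroup -(Lagrange (subsetIl 'C_G(X) K)) pnatM -/(pgroup p Y) pY indexgI.
rewrite -card_quotient ?(subset_trans (subsetIl _ _)) //.
have: 'C_G(X) / K \subset P / K by rewrite -(quotientMidl K P) defG quotientS ?subsetIl.
by move/pgroupS; apply; apply: quotient_pgroup.
Qed.

Let ntP : P :!=: 1.
Proof.
apply: contraNneq not_pnilG => P1; rewrite -(setIidPl (_ : G \subset 'C(X))).
  by apply: pnilpotentS cGX _; apply: pgroup_pnilpotent.
have X1: X :=: 1 by apply/trivgP; rewrite -P1.
by rewrite X1 cent1T subsetT.
Qed.

Let q_group_p_group (R : {group gT}) : X \subset R -> R \subset K -> p.-group R -> R :=: X.
Proof.
move=> sXR sRK pR; apply/eqP; rewrite eqEsubset sXR andbT.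
have nXR: R \subset 'N(X) by rewrite (subset_trans sRK) // (subset_trans sKG).
rewrite -quotient_sub1 // -(setIid (R / X)) coprime_TIg //.
have qR: q.-group (R / X) := pgroupS (quotientS X sRK) qKX.
apply: (pnat_coprime (quotient_pgroup X pR)).
by apply: sub_in_pnat qR => r _ /eqP->; rewrite inE /= inE.
Qed.

Let tiKP : K :&: P = X.
Proof.
apply: q_group_p_group; rewrite ?subsetIl ?subsetI ?sXK //.
exact: pgroupS (subsetIr _ _) pP.
Qed.

(** K / X is a minimal normal subgroup of G / X. For M smaller than K, the proper subgroup M P is
    p-nilpotent; its p'-core centralises X, so lies in X and is trivial. Thus M is a p-group between
    X and K. *)
Let minK (M : {group gT}) : X \subset M -> M \subset K -> G \subset 'N(M) -> M != K -> M :=: X.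
Proof.
move=> sXM sMK nMG neMK; apply: q_group_p_group => //.
pose L := (M <*> P)%G; have nMP := subset_trans sPG nMG.
have sMG := subset_trans sMK sKG.
have sLG: L \subset G by rewrite join_subG sMG.
have sPL: P \subset L := joing_subr _ _.
(* If M P were G, the modular law would give K = M (K :&: P) = M X = M. *)
have prL: L \proper G.
  rewrite properEneq sLG andbT; apply: contraNneq neMK => eqLG.
  rewrite -val_eqE /= eqEsubset sMK /= -(mulSGid sXM) -tiKP.
  rewrite group_modr // subsetI subxx /= -norm_joinEl // joingC.
  by rewrite -[M <*> P]/(gval L) eqLG.
have pnL := over_P sPL prL.
have nsXL: X <| L := normalS (subset_trans sXP sPL) sLG nsXG.
have sOX: 'O_p^'(L) \subset X.
  apply: subset_trans cGX; rewrite subsetI (pnilpotent_p'pcore_cent pnL) // andbT.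
  exact: subset_trans (pcore_sub _ _) sLG.
have O1: 'O_p^'(L) = 1.
  apply/trivgP; rewrite -(coprime_TIg (pnat_coprime pX (pcore_pgroup p^' L))).
  by rewrite subsetI sOX subxx.
have pL: p.-group L by have := pnilpotent_index pnL; rewrite O1 indexg1.
by apply: pgroupS pL; apply: joing_subl.
Qed.

Let neKX : K != X.
Proof.
apply: contraNneq not_pnilG => eqKX; apply: pgroup_pnilpotent.
by rewrite -defG eqKX pgroupM pX.
Qed.

Let abKX : abelian (K / X).
Proof.
have nXK := subset_trans sKG nXG.
pose M := (K^`(1) <*> X)%G; have sK'K: K^`(1) \subset K := der_sub 1 K.
have nXK' := subset_trans sK'K nXK.
have quoM: M / X = (K / X)^`(1) by rewrite quotientYidr // quotient_der.
have eqM: M :=: X.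
  apply: minK; first exact: joing_subr.
  - by rewrite join_subG sK'K.
  - by rewrite normsY // gFnorm_trans.
  apply: contraNneq neKX => eqMK; rewrite -val_eqE eqEsubset sXK andbT /=.
  rewrite -quotient_sub1 //.
  have: (K / X)^`(1) = K / X by rewrite -quoM eqMK.
  move=> K'; apply/idPn; rewrite subG1 => ntKX.
  have := sol_der1_proper (pgroup_sol qKX) (subxx _) ntKX.
  by rewrite K' properxx.
by rewrite (sameP derG1P eqP) -quoM eqM trivg_quotient.
Qed.

(** The contradiction is between [offender_bound], for the normaliser of Q in E X acting on W, and
    the maximal order of E among the elementary abelian subgroups of P. *)
Lemma pnilpotent_minimal_counterexample : False.
Proof.
have nXK := subset_trans sKG nXG.
have [Q sylQ] := Sylow_exists q K; have [sQK qQ _] := and3P sylQ.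
have nXQ := subset_trans sQK nXK.
have q'p: q^'.-group X by apply: sub_in_pnat pX => r _ /eqP->; rewrite !inE eq_sym.
have p'Q: p^'.-group Q by apply: sub_in_pnat qQ => r _ /eqP->; rewrite !inE.
have tiXQ: X :&: Q = 1 by rewrite coprime_TIg // (pnat_coprime pX).
have defK: X * Q = K.
  apply/eqP; rewrite eqEsubset mul_subG //= -quotientSK // (_ : Q / X = K / X) //.
  apply: pHall_id qKX; exact: quotient_pHall.
have abQ: abelian Q.
  have := quotientS X sQK => /abelianS/(_ abKX); rewrite (isog_abelian (_ : Q \isog Q / X)) //.
  exact: quotient_isog.
(* Otherwise J(P) = J(X) would be normal in G, against [no_normal]. *)
have [E EP nsEX]: exists2 E, E \in 'E_p^('r_p(P))(P) & ~~ (E \subset X).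
  apply/exists_inP/contraT; rewrite negb_exists_in => /forall_inP sEX.
  have sJX: ThompsonJ p P \subset X.
    by rewrite gen_subG; apply/bigcupsP=> E /sEX/negbNE.
  have eqJ := ThompsonJ_sub_eq sXP sJX.
  case/negP: (no_normal (ThompsonJ_char p P) (ThompsonJ_nontrivial pP ntP)).
  by rewrite /= -eqJ; apply: char_norm_trans nXG; apply: ThompsonJ_char.
have [sEP abelE dimE] := pnElemP EP.
pose W := ('Ohm_1('Z(X)))%G.
have pZX: p.-group 'Z(X) := pgroupS (center_sub X) pX.
have abelW: p.-abelem W := Ohm1_abelem pZX (center_abelian X).
have sWZ: W \subset 'Z(X) := Ohm_sub 1 _.
have cXW: X \subset 'C(W) by rewrite centsC (subset_trans sWZ) ?subsetIr.
have sWX: W \subset X := subset_trans sWZ (center_sub X).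
have nWG: G \subset 'N(W) by rewrite !gFnorm_trans.
(* By minimality the alternative is that K centralises W. But Z(P) lies in C_G(X), hence in Z(X), so
   W contains Ohm_1(Z(P)), which would then be normal in G = K P. *)
have CKW: 'C_K(W) = X.
  apply: (@minK 'C_K(W)%G).
  - by rewrite subsetI sXK.
  - exact: subsetIl.
  - by rewrite normsI // norms_cent.
  have pZP: p.-group 'Z(P) := pgroupS (center_sub P) pP.
  have chY: 'Ohm_1('Z(P)) \char P by rewrite !gFchar_trans.
  have ntY: 'Ohm_1('Z(P)) != 1.
    by rewrite Ohm1_eq1 center_nil_eq1 ?(pgroup_nil pP).
  apply: contraNneq (no_normal chY ntY) => eqCK.
  have sYW: 'Ohm_1('Z(P)) \subset W.
    apply: OhmS; rewrite subsetI.
    have sZX: 'Z(P) \subset X.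
      apply: subset_trans cGX; rewrite subsetI (subset_trans (center_sub P)) //.
      by rewrite (subset_trans (subsetIr _ _)) ?centS.
    by rewrite sZX (subset_trans (subsetIr _ _)) ?centS.
  rewrite -defG mul_subG //; last by rewrite !gFnorm_trans.
  rewrite cents_norm //; apply: subset_trans (centS sYW).
  by rewrite -eqCK subsetIr.
have CQW1 : 'C_Q(W) = 1.
  apply/trivgP; rewrite -tiXQ setIC -CKW subsetI.
  by rewrite subsetIl setSI.
pose EX := (E <*> X)%G; have nXE : E \subset 'N(X) := subset_trans sEP (subset_trans sPG nXG).
have sEXP : EX \subset P by rewrite join_subG sEP.
have sEXG : EX \subset G := subset_trans sEXP sPG.
pose B := 'N_EX(Q)%G; pose Z := (B :&: X)%G.
have sXEX : X \subset EX := joing_subr _ _.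
have sBEX : B \subset EX := subsetIl _ _.
have nXB : B \subset 'N(X) by rewrite (subset_trans sBEX) // (subset_trans sEXG).
(* Frattini argument: Q is a Sylow q-subgroup of K = X Q, so its conjugates under E X are already
   conjugates under X. *)
have defEX : EX \subset B * X.
  apply/subsetP=> g EXg; have Gg := subsetP sEXG g EXg.
  have sylQg: q.-Sylow(K) (Q :^ g).
    by rewrite pHallE -(normsP nKG g Gg) conjSg sQK cardJg cardJg -(card_Hall sylQ) /=.
  have [k Kk eqQk] := Sylow_trans sylQ sylQg.
  move: Kk; rewrite -defK -(normC nXQ) => /mulsgP[y x Qy Xx def_k].
  have eqQx: Q :^ g = Q :^ x by rewrite [LHS]eqQk def_k conjsgM (conjGid Qy).
  apply/mulsgP; exists (g * x^-1) x; rewrite ?mulgKV //.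
  rewrite inE groupM ?groupV ?(subsetP sXEX x) //=.
  by apply/normP; rewrite conjsgM eqQx conjsgK.
have pB : p.-group B by rewrite (pgroupS _ pP) // (subset_trans sBEX).
have sBG := subset_trans sBEX sEXG.
have nsZB : Z <| B by rewrite /normal subsetIl normsI ?normG.
have quoEX : EX / X = E / X by rewrite /= quotientYidr.
have abelBZ : p.-abelem (B / Z).
  have isoB: B / Z \isog B / X by rewrite /= setIC; apply: second_isog.
  rewrite (isog_abelem isoB); apply: abelemS (quotient_abelem X abelE).
  by rewrite /= -quoEX quotientS.
have cQZ : Z \subset 'C(Q).
  apply/commG1P/trivgP; rewrite -tiXQ subsetI.
  rewrite (subset_trans (commSg _ (subsetIr _ _))) ?commg_subl //=.
  by rewrite commg_subr (subset_trans (subsetIl _ _)) ?subsetIr.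
have cWZ : Z \subset 'C(W) by rewrite (subset_trans (subsetIr _ _)).
(* The elements of P centralising K / X form a subgroup [T] normalised by both K and P, so [T] lies
   in O_p(G) = X. Centralising Q implies centralising K / X, the image of Q. *)
have sCBZ : 'C_B(Q) \subset Z.
  rewrite subsetI subsetIl /=; pose T := (coset X @*^-1 'C(K / X) :&: P)%G.
  have sTG: T \subset G by rewrite subIset ?sPG ?orbT.
  have sXT: X \subset T by rewrite subsetI sXP sub_cosetpre.
  have cKT: [~: K, T] \subset X.
    rewrite -quotient_cents2 ?(subset_trans sTG) // centsC.
    by apply: subset_trans (quotientS X (subsetIl _ _)) _; rewrite /= cosetpreK.
  have nTG: G \subset 'N(T).
    rewrite -defG mul_subG //; last first.
      rewrite normsI ?normG // norm_quotient_pre ?(subset_trans sPG) //.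
      by rewrite norms_cent // quotient_norms // (subset_trans sPG).
    by rewrite -commg_subr (subset_trans cKT).
  have sTX: T \subset X.
    apply: (@subset_trans _ _ 'O_p(G)); last by rewrite pcoreX.
    by rewrite pcore_max ?(pgroupS (subsetIr _ _) pP) // /normal sTG.
  apply: subset_trans sTX.
  have sCP: 'C_B(Q) \subset P by rewrite (subset_trans (subsetIl _ _)) // (subset_trans sBEX).
  rewrite subsetI sCP andbT -sub_quotient_pre ?(subset_trans (subset_trans sCP sPG)) //.
  by rewrite -defK quotientMidl quotient_cents ?subsetIr.
have nsBZ: ~~ (B \subset Z).
  apply: contra nsEX => sBZ; apply: subset_trans (joing_subl E X) _.
  apply: subset_trans defEX _; rewrite mul_subG //.
  exact: subset_trans sBZ (subsetIr _ _).
have nQB : B \subset 'N(Q) := subsetIr _ _.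
have nWB := subset_trans sBG nWG.
have nWQ := subset_trans (subset_trans sQK sKG) nWG.
have := offender_bound p_pr odd_p abelW abQ p'Q pB nsZB abelBZ nQB nWB nWQ cQZ cWZ sCBZ CQW1 nsBZ.
apply/negP; rewrite -leqNgt.
have sCEB: E :&: W \subset 'C_W(B).
  rewrite subsetI subsetIr /= (subset_trans _ (centS sBEX)) // centY subsetI.
  rewrite (subset_trans (subsetIl _ _) (abelem_abelian abelE)) /=.
  by rewrite (subset_trans (subsetIr _ _)) // centsC.
have oB: (#|B| = #|Z| * #|E : X|)%N.
  rewrite -(LagrangeI B X); congr (_ * _)%N.
  have quoB: B / X = E / X.
    have nXEX : EX \subset 'N(X) := subset_trans sEXG nXG.
    apply/eqP; rewrite -quoEX eqEsubset quotientS //= quotientSK //.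
    by rewrite -(normC nXB).
  by rewrite -(card_quotient nXB) -(card_quotient nXE) quoB.
(* (E :&: X) W is elementary abelian because X centralises W, so its order is at most |E|. *)
have leE: (#|E :&: X| * #|W| <= #|E| * #|E :&: W|)%N.
  have cEXW: W \subset 'C(E :&: X) by rewrite centsC (subset_trans (subsetIr _ _)).
  pose D := ((E :&: X) <*> W)%G.
  have abelD: p.-abelem D.
    by rewrite (cprod_abelem p (cprodEY cEXW)) abelW (abelemS (subsetIl _ _) abelE).
  have sDP: D \subset P by rewrite join_subG subIset ?sEP //= (subset_trans sWX).
  have leD: #|D| <= #|E|.
    rewrite (card_pgroup (abelem_pgroup abelD)) (card_pgroup (abelem_pgroup abelE)).
    rewrite leq_exp2l ?prime_gt1 // dimE; apply: logn_le_p_rank.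
    exact/pElemP.
  rewrite mul_cardG -cent_joinEr // leq_mul // subset_leq_card //.
  by rewrite setSI ?subsetIl.
(* Multiplying by |E :&: X| turns |E : X|, the index of E :&: X in E, into |E|. Then [leE] and
   [sCEB] give |Z| |W| <= |B| |C_W(B)|. *)
rewrite oB -(leq_pmul2l (cardG_gt0 (E :&: X))) mulnCA.
apply: leq_trans (leq_mul (leqnn #|Z|) leE) _.
rewrite -(LagrangeI E X) -!mulnA mulnCA leq_mul2l; apply/orP; right.
by rewrite !leq_mul // subset_leq_card.
Qed.

End MinimalCounterexample.

(** * The induction for Thompson's criterion *)

Section ThompsonPcomplement.

Lemma char_quotient_TI (gT : finGroupType) (M P : {group gT}) (Y : {group coset_of M}) :
    P \subset 'N(M) -> M :&: P = 1 -> Y \char P / M ->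
  exists2 Y0 : {group gT}, Y0 \char P & Y = (Y0 / M)%G.
Proof.
move=> nMP tiMP chY; have sYP := char_sub chY.
have /isomP[injf imf] := quotient_isom nMP tiMP.
set f := restrm_morphism nMP _ in injf imf.
have sYf : Y \subset f @* P by rewrite imf.
exists (invm injf @* Y)%G.
  have := injm_char (injm_invm injf) (subxx _) (_ : Y \char (f @* P)%G).
  by rewrite /= morphim_invm //; apply; rewrite imf.
apply/val_inj; rewrite /= -[LHS](morphpreK sYf) /= morphim_invmE.
by rewrite morphim_restrm (setIidPr (subsetIl _ _)).
Qed.

Lemma Sylow_quotient_lift (gT : finGroupType) p (G M : {group gT}) (Pb : {group coset_of M}) :
    M <| G -> p.-Sylow(G / M) Pb ->
  exists2 P : {group gT}, p.-Sylow(G) P & Pb = (P / M)%G.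
Proof.
move=> nsMG sylPb; have [P0 sylP0] := Sylow_exists p G.
have nMP0 := subset_trans (pHall_sub sylP0) (normal_norm nsMG).
have [_ /morphimP[x Nx Gx ->] defPb] := Sylow_trans (quotient_pHall nMP0 sylP0) sylPb.
exists (P0 :^ x)%G; first by rewrite pHallJ.
by apply/val_inj; rewrite /= defPb quotientJ.
Qed.

Variable p : nat.
Hypotheses (p_pr : prime p) (odd_p : odd p).

Definition char_local_pnilpotent (gT : finGroupType) (G : {group gT}) :=
  forall P Y : {group gT},
  p.-Sylow(G) P -> Y \char P -> Y :!=: 1 -> pnilpotent p 'N_G(Y).

Lemma char_local_quotient_p'core (gT : finGroupType) (G M : {group gT}) :
  M <| G -> p^'.-group M -> char_local_pnilpotent G -> char_local_pnilpotent (G / M)%G.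
Proof.
move=> nsMG p'M locG Pb Y sylPb; have [P sylP ->] := Sylow_quotient_lift nsMG sylPb.
have [sPG pP _] := and3P sylP.
have nMP := subset_trans sPG (normal_norm nsMG).
have tiMP: M :&: P = 1 by rewrite setIC coprime_TIg // (pnat_coprime pP).
case/(char_quotient_TI nMP tiMP)=> Y0 chY0 -> ntY.
have ntY0: Y0 :!=: 1 by apply: contraNneq ntY => /= ->; rewrite quotient1.
have sYP := char_sub chY0.
apply: pnilpotentS (norm_quotient_p'group nsMG p'M (subset_trans sYP sPG) (pgroupS sYP pP)) _.
have nMN: 'N_G(Y0) \subset 'N(M) by rewrite (subset_trans (subsetIl _ _)) ?normal_norm.
exact: pnilpotent_quotient nMN (locG P Y0 sylP chY0 ntY0).
Qed.

Lemma char_local_quotient_pgroup (gT : finGroupType) (G X : {group gT}) :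
    X <| G -> p.-group X ->
    (forall P Y : {group gT}, p.-Sylow(G) P -> Y \subset G -> p.-group Y ->
       X \proper Y -> P \subset 'N(Y) -> pnilpotent p 'N_G(Y)) ->
  char_local_pnilpotent (G / X)%G.
Proof.
move=> nsXG pX over_X Pb Yb sylPb; have [P sylP ->] := Sylow_quotient_lift nsXG sylPb.
have [sPG pP _] := and3P sylP; have [sXG nXG] := andP nsXG.
have nXP := subset_trans sPG nXG.
move=> chY ntY; have sXP: X \subset P.
  have [x Gx sXPx] := Sylow_subJ sylP sXG pX.
  by rewrite -(conjSg _ _ x) (normsP nXG x Gx).
have nsXP: X <| P by rewrite /normal sXP.
have [Y defY sXY sYP] := inv_quotientS nsXP (char_sub chY).
have nsXY: X <| Y by rewrite /normal sXY (subset_trans sYP).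
have prXY: X \proper Y.
  rewrite properEneq sXY andbT; apply: contraNneq ntY => eqXY.
  by rewrite defY -eqXY trivg_quotient.
have nYP: P \subset 'N(Y).
  rewrite -(quotientGK nsXY) norm_quotient_pre // -defY.
  by have /andP[] := char_normal chY.
have pnN := over_X P Y sylP (subset_trans sYP sPG) (pgroupS sYP pP) prXY nYP.
rewrite /= defY -quotient_normG // -quotientGI //.
apply: pnilpotent_quotient pnN; exact: subset_trans (subsetIl _ _) nXG.
Qed.

(** After factoring out the p'-core, Frobenius' criterion supplies a nontrivial p-subgroup with
    non-p-nilpotent normaliser. One of maximal weight [w] is normal with p-nilpotent quotient, which
    leads to the configuration refuted by [pnilpotent_minimal_counterexample]. *)
Lemma Thompson_pnilpotent (gT : finGroupType) (G : {group gT}) :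
  char_local_pnilpotent G -> pnilpotent p G.
Proof.
have [m] := ubnP #|G|; elim: m => // m IHm in gT G *; move=> /ltnSE-leGm locG.
have [O1 | ntO] := eqVneq 'O_p^'(G) 1; last first.
  have nsOG : 'O_p^'(G) <| G := pcore_normal _ _.
  have pnGO: pnilpotent p (G / 'O_p^'(G)).
    apply: IHm.
      by apply: leq_trans leGm; apply: ltn_quotient; rewrite ?pcore_sub.
    exact: char_local_quotient_p'core (pcore_pgroup _ _) locG.
  apply: (normal_p'Hall_pnilpotent nsOG (pcore_pgroup _ _)).
  have := pnilpotent_index pnGO; rewrite /= trivg_pcore_quotient indexg1.
  by rewrite card_quotient ?normal_norm.
apply/idPn=> npG.
pose bad (X : {group gT}) := [&& X \subset G, p.-group X, X :!=: 1 & ~~ pnilpotent p 'N_G(X)].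
have [X0 badX0]: exists X0, bad X0.
  apply/existsP/contraT; rewrite negb_exists => /forallP nbad; case/negP: npG.
  apply: Frobenius_pnilpotent => D sDG pD.
  have [D1 | ntD] := eqVneq (gval D) 1.
    by rewrite quotientS1 ?pgroup1 // centsC D1 sub1G.
  apply: pnilpotent_norm_cent => //.
  by have := nbad D; rewrite /bad sDG pD ntD /= negbK.
(* A lexicographic weight: first the p-part of |N_G(X)|, then |X|, which is always below the factor
   |G| + 1. *)
pose w (X : {group gT}) := (#|'N_G(X)|`_p * #|G|.+1 + #|X|)%N.
have [X /and4P[sXG pX ntX npX] maxX] := @arg_maxnP _ X0 bad w badX0.
have good (Y : {group gT}) :
    Y \subset G -> p.-group Y -> Y :!=: 1 -> w X < w Y -> pnilpotent p 'N_G(Y).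
  move=> sYG pY ntY ltw; apply: contraLR ltw => npY; rewrite -leqNgt; apply: maxX.
  by rewrite /bad sYG pY ntY.
have sizeG (Y : {group gT}) : Y \subset G -> #|Y| < #|G|.+1.
  by move=> sYG; rewrite ltnS subset_leq_card.
(* Otherwise induction applies to N_G(X). If its Sylow subgroup S is not Sylow in G, then N_P(S)
   exceeds S and normalises every Y characteristic in S, so Y has larger weight than X and is
   good. *)
have nXG: G \subset 'N(X).
  apply/setIidPl/eqP; rewrite eqEcard subsetIl leqNgt /=; apply: contra npX => ltN.
  apply: IHm; first exact: leq_trans ltN leGm.
  move=> S Y sylS chY ntY; have [sSN pS _] := and3P sylS.
  have sSG := subset_trans sSN (subsetIl _ _).
  have [sylSG | nsylSG] := boolP (p.-Sylow(G) S).
    by apply: pnilpotentS (locG S Y sylSG chY ntY); rewrite setSI ?subsetIl.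
  apply: (@pnilpotentS p _ 'N_G(Y)%G); first by rewrite setSI ?subsetIl.
  have sYS := char_sub chY; have sYG := subset_trans sYS sSG.
  apply: good => //; first exact: pgroupS pS.
  have [P sylP sSP] := Sylow_superset sSG pS; have [sPG pP _] := and3P sylP.
  have prSP: S \proper P.
    by rewrite properEneq sSP andbT; apply: contraNneq nsylSG => ->.
  have prN := nilpotent_proper_norm (pgroup_nil pP) prSP.
  have sNN: 'N_P(S) \subset 'N_G(Y).
    exact: setISS sPG (char_norms chY).
  have leN: #|'N_G(X)|`_p < #|'N_G(Y)|`_p.
    rewrite -(card_Hall sylS) (leq_trans (proper_card prN)) //.
    rewrite dvdn_leq ?part_gt0 // -(part_pnat_id (pgroupS (subsetIl P 'N(S)) pP)).
    by rewrite partn_dvd ?cardSg.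
  rewrite /w (leq_trans (_ : _ < (#|'N_G(X)|`_p).+1 * #|G|.+1)%N) //.
    by rewrite mulSn (addnC (_ * _)%N #|X|) ltn_add2r sizeG.
  by rewrite (leq_trans (leq_mul leN (leqnn _))) ?leq_addr.
have nsXG: X <| G by apply/andP.
have over_X (P Y : {group gT}) : p.-Sylow(G) P -> Y \subset G -> p.-group Y ->
     X \proper Y -> P \subset 'N(Y) -> pnilpotent p 'N_G(Y).
  move=> sylP sYG pY prXY nYP; apply: good => //.
    by apply: contraTneq prXY => ->; rewrite properE sub1G andbF.
  have sPN : P \subset 'N_G(Y) by rewrite subsetI (pHall_sub sylP).
  have sylPN := pHall_subl sPN (subsetIl _ _) sylP.
  rewrite /w -(card_Hall sylPN) (setIidPl nXG) -(card_Hall sylP).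
  by rewrite ltn_add2l proper_card.
have pnGX: pnilpotent p (G / X).
  apply: IHm; first by apply: leq_trans leGm; apply: ltn_quotient.
  exact: char_local_quotient_pgroup.
have [P sylP] := Sylow_exists p G; have [sPG pP _] := and3P sylP.
have over_P (L : {group gT}) : P \subset L -> L \proper G -> pnilpotent p L.
  move=> sPL prL; apply: IHm; first by apply: leq_trans leGm; apply: proper_card.
  move=> S Y sylS chY ntY; have sLG := proper_sub prL.
  apply: (@pnilpotentS p _ 'N_G(Y)%G); first by rewrite setSI.
  apply: (locG S) => //; rewrite pHallE (subset_trans (pHall_sub sylS)) //=.
  by rewrite (card_Hall sylS) -(card_Hall (pHall_subl sPL sLG sylP)) (card_Hall sylP).
pose K := (coset X @*^-1 'O_p^'(G / X))%G.
have nsKG : K <| G by rewrite -(quotientGK nsXG) cosetpre_normal pcore_normal.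
have [sKG nKG] := andP nsKG.
have sXK : X \subset K by apply: sub_cosetpre.
have quoK : K / X = 'O_p^'(G / X) by rewrite /= cosetpreK.
have nXK := subset_trans sKG nXG.
have p'KX : p^'.-group (K / X) by rewrite quoK pcore_pgroup.
have pGK : p.-nat #|G : K|.
  have <-: #|G / X : K / X| = #|G : K|.
    by apply: index_quotient_eq => //; rewrite subIset // sXK orbT.
  by rewrite quoK pnilpotent_index.
have nXP := subset_trans sPG nXG.
have nKP := subset_trans sPG nKG.
have defG : K * P = G.
  have quoP : P / K = G / K.
    apply: (@pHall_id _ p); first exact: quotient_pHall.
    by rewrite /pgroup card_quotient.
  apply/eqP; rewrite eqEsubset mul_subG //; have <- := quotientSK P nKG.
  by rewrite quoP subxx.
(* If it were a p-group, a Schur-Zassenhaus complement of X in K would centralise X, hence be normal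
   in K, making K and then G p-nilpotent. *)
have npK : ~~ p.-group (K / 'C(X)).
  apply: contra npG => pKC.
  have hallX : Hall K X.
    rewrite /Hall sXK -card_quotient //; exact: pnat_coprime pX p'KX.
  have nsXK : X <| K := normalS sXK sKG nsXG.
  have [H /complP[tiXH defK]] := splitsP (SchurZassenhaus_split hallX nsXK).
  have sHK : H \subset K by rewrite -defK mulG_subr.
  have p'H : p^'.-group H.
    have nXH := subset_trans sHK nXK.
    rewrite /pgroup (card_isog (quotient_isog nXH tiXH)).
    exact: pgroupS (quotientS X sHK) p'KX.
  have cXH : H \subset 'C(X).
    have nCH : H \subset 'N('C(X)) by rewrite norms_cent // (subset_trans sHK).
    rewrite -quotient_sub1 //; apply/trivgP.
    have pHC : p.-group (H / 'C(X)) := pgroupS (quotientS _ sHK) pKC.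
    rewrite /= -[LHS]setIid coprime_TIg // (pnat_coprime pHC) //.
    exact: quotient_pgroup.
  have nsHK : H <| K.
    by rewrite /normal sHK -defK mul_subG ?normG // cents_norm // centsC.
  have pnK : pnilpotent p K.
    apply: (normal_p'Hall_pnilpotent nsHK p'H).
    by rewrite -divgS // -defK TI_cardMg // mulnK.
  by apply: (pnilpotent_of_normal nsKG) pnK; rewrite /pgroup card_quotient.
(* Take a prime q other than p dividing |K / C(X)|. Coprime action gives a P-invariant Sylow
   q-subgroup of K / X, with preimage [Q1]; the cases are Q1 P = G and Q1 P proper. *)
case/negP: npK; apply/pgroupP=> q q_pr dvdq; rewrite inE; apply: contraT => neqp.
have coKP : coprime #|K / X| #|P / X|.
  by rewrite coprime_sym (pnat_coprime (quotient_pgroup X pP)).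
have nKPX : P / X \subset 'N(K / X) := quotient_norms X nKP.
have [Qb sylQb nQbP] := sol_coprime_Sylow_exists q (pgroup_sol (quotient_pgroup X pP)) nKPX coKP.
have [sQbK qQb _] := and3P sylQb.
pose Q1 := (coset X @*^-1 Qb)%G.
have quoQ1 : Q1 / X = Qb by rewrite /= cosetpreK.
have sXQ1 : X \subset Q1 by apply: sub_cosetpre.
have sQ1K : Q1 \subset K by rewrite -(quotientSGK (subsetIl _ _) sXK) quoQ1.
have sQ1G := subset_trans sQ1K sKG.
have nQ1P : P \subset 'N(Q1) by apply: norm_quotient_pre.
have defL : Q1 * P = Q1 <*> P by rewrite norm_joinEr.
have sLG : Q1 <*> P \subset G by rewrite join_subG sQ1G.
have [eqLG | neLG] := eqVneq (Q1 <*> P) G.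
  have nsQ1G : Q1 <| G by rewrite -eqLG normalYl.
  apply/idPn=> _.
  apply: (@pnilpotent_minimal_counterexample gT p q G P X Q1) => //.
  - by rewrite quoQ1.
  - by rewrite defL.
  - by move=> Y sYG pY; apply: over_X.
  by move=> Y; apply: locG.
(* A proper Q1 P is p-nilpotent and induces a p-group on X. So a Sylow q-subgroup of K centralises
   X, against the choice of q. *)
have prL : (Q1 <*> P)%G \proper G by rewrite properEneq neLG.
have pnL := over_P _ (joing_subr Q1 P) prL.
have nXL := subset_trans sLG nXG.
have sXL : X \subset Q1 <*> P by rewrite (subset_trans sXQ1) ?joing_subl.
have pLC : p.-group ((Q1 <*> P) / 'C(X)).
  have := @pnilpotent_norm_cent p gT (Q1 <*> P)%G X pX sXL.
  by rewrite /= (setIidPl nXL); apply.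
have [Q sylQ] := Sylow_exists q Q1; have [sQQ1 qQ _] := and3P sylQ.
have sQK := subset_trans sQQ1 sQ1K.
have sylQK : q.-Sylow(K) Q.
  rewrite /pHall sQK qQ -(Lagrange_index sQ1K sQQ1) pnatM.
  have <-: #|K / X : Q1 / X| = #|K : Q1|.
    by apply: index_quotient_eq => //; rewrite subIset // sXQ1 orbT.
  by rewrite quoQ1; case/and3P: sylQb => _ _ ->; case/and3P: sylQ.
have nCK : K \subset 'N('C(X)) by rewrite norms_cent.
have nCQ := subset_trans sQK nCK.
have QC1 : Q / 'C(X) = 1.
  rewrite -[LHS]setIid coprime_TIg //.
  have pQC : p.-group (Q / 'C(X)).
    by apply: pgroupS pLC; rewrite quotientS // (subset_trans sQQ1) ?joing_subl.
  apply: (pnat_coprime pQC); apply: sub_in_pnat (quotient_pgroup 'C(X) qQ) => r _ /eqP->.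
  by rewrite !inE.
have := card_Hall (quotient_pHall nCQ sylQK).
rewrite /= QC1 cards1 => /esym/eqP; rewrite partn_eq1 // => q'KC.
by move: q'KC; rewrite p'natE // dvdq.
Qed.

End ThompsonPcomplement.

(** * Fixed-point-free automorphisms of prime order *)

Section FixedPointFree.

Section FrobeniusKernel.

Import FiniteModule GRing.Theory.
Local Open Scope ring_scope.

(* Summing u over the conjugates of <x> under Q gives 0; the terms other than
   u *+ #|Q| add up to an element fixed by Q. *)
Lemma fpf_coprime_cent (gT : finGroupType) (V Q : {group gT}) x :
    prime #[x]%g -> x \in 'N(Q) -> x \in 'N(V) -> Q \subset 'N(V) -> abelian V ->
    'C_Q[x]%g = 1%g -> 'C_V[x]%g = 1%g -> coprime #|V| #|Q| ->
  Q \subset 'C(V).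
Proof.
set r := #[x]%g => r_pr nQx nVx nVQ abV CQ1 CV1 coVQ.
have cycE i : (0 < i < r)%N -> 'C_Q[x ^+ i]%g = 1%g.
  case/andP=> i0 ltir; rewrite -CQ1; congr (_ :&: _); rewrite -!cent_cycle.
  congr 'C(_); apply/esym/eqP; rewrite -/(generator _ _) generator_coprime -/r.
  by rewrite prime_coprime // gtnNdvd.
have nVb y : y \in Q -> (x ^ y)%g \in 'N(V) by move=> Qy; rewrite groupJ // (subsetP nVQ).
have norm0 (u : fmod_of abV) y : y \in Q -> \sum_(i < r) u ^@ ((x ^ y) ^+ i)%g = 0.
  move=> Qy; apply: sum_cycle_eq0; first exact: nVb.
    by rewrite -conjXg expg_order conj1g.
  rewrite -(normsP nVQ y Qy) -[RHS](conjs1g y) -CV1 conjIg; congr (_ :&: _).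
  by rewrite cent1J.
pose S (w : fmod_of abV) := \sum_(z in Q) w ^@ z.
have Sfix w q : q \in Q -> S w ^@ q = S w.
  move=> Qq; rewrite /S actr_sum [RHS](reindex_inj (mulIg q)) /=.
  apply: eq_big => [z | z Qz]; first by rewrite groupMr.
  by rewrite actrM // (subsetP nVQ).
have col w i : (0 < i < r)%N -> \sum_(y in Q) w ^@ ((x ^ y) ^+ i)%g = S (w ^@ (x ^+ i)%g).
  move=> i_r; pose h y := [~ x ^+ i, y]%g.
  have nQxi : (x ^+ i)%g \in 'N(Q) by rewrite groupX.
  have sh : h @: Q \subset Q.
    apply/subsetP=> _ /imsetP[y Qy ->].
    by rewrite /h commgEr groupM // memJ_norm ?groupV.
  have injh : {in Q &, injective h}.
    move=> y z Qy Qz /(congr1 (mulg (x ^+ i))); rewrite /h -!conjg_mulR => eqyz.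
    apply/eqP; rewrite eq_mulgV1 -in_set1 -[[set _]](cycE i i_r) inE groupM ?groupV //=.
    by apply/cent1P/commute_sym/commgP/conjg_fixP; rewrite conjgM eqyz conjgK.
  have defQ : h @: Q = Q by apply/eqP; rewrite eqEcard sh (card_in_imset injh) leqnn.
  rewrite /S -{2}defQ big_imset //=; apply: eq_bigr => y Qy.
  have nVh : h y \in 'N(V) by rewrite (subsetP nVQ) // (subsetP sh) ?imset_f.
  rewrite -actrM ?(groupX i nVx) //.
  by rewrite /h -conjg_mulR conjXg.
rewrite centsC; apply/centsP=> v Vv q Qq; pose u := fmod abV v.
have fixq : (u *+ #|Q|) ^@ q = u *+ #|Q|.
  have: \sum_(y in Q) \sum_(i < r) u ^@ ((x ^ y) ^+ i)%g = 0.
    by rewrite big1 // => y Qy; apply: norm0.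
  rewrite exchange_big (bigD1 (Ordinal (prime_gt0 r_pr))) //=.
  rewrite (eq_bigr (fun=> u)); last by move=> y _; rewrite expg0 actr1.
  rewrite sumr_const => /eqP; rewrite addr_eq0 => /eqP->.
  rewrite actNr actr_sum; congr (- _); apply: eq_bigr => i i0.
  by rewrite col ?Sfix // lt0n ltn_ord andbT.
have vq : ((v ^+ #|Q|) ^ q = v ^+ #|Q|)%g.
  have eqv : fmval (u *+ #|Q|) = (v ^+ #|Q|)%g by rewrite fmvalZ fmodK.
  by rewrite -eqv -fmvalJ ?fixq // (subsetP nVQ).
apply/commgP/conjg_fixP.
by rewrite -(expgK coVQ Vv) conjXg vq.
Qed.

End FrobeniusKernel.

(** The r-group <x> fixes only 1 in G, so |G| is congruent to 1 modulo r. *)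
Lemma fpf_coprime (gT : finGroupType) (G : {group gT}) x :
  prime #[x] -> x \in 'N(G) -> 'C_G[x] = 1 -> coprime #|G| #[x].
Proof.
move=> r_pr nGx C1; rewrite coprime_sym prime_coprime //; apply/negP=> rG.
have := @pgroup_fix_mod _ _ [set: gT]%G 'J #[x] <[x]>%G G.
rewrite /pgroup -/#[x] pnat_id // astabsJ cycle_subG => /(_ isT nGx).
rewrite afixJ cent_cycle C1 cards1 (eqP (_ : #|G| %% #[x] == 0)) // modn_small ?prime_gt1 //.
Qed.

Lemma fpf_quotient (gT : finGroupType) (G M : {group gT}) x :
    prime #[x] -> x \in 'N(G) -> 'C_G[x] = 1 -> M <| G -> x \in 'N(M) ->
  [/\ prime #[coset M x], coset M x \in 'N(G / M) & 'C_(G / M)[coset M x] = 1].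
Proof.
move=> r_pr nGx C1 nsMG nMx; have [sMG nMG] := andP nsMG.
have coGx := fpf_coprime r_pr nGx C1.
have nM : <[x]> \subset 'N(M) by rewrite cycle_subG.
have nG : <[x]> \subset 'N(G) by rewrite cycle_subG.
split.
- have: #[coset M x] %| #[x] by apply: morph_order.
  case/primeP: (r_pr) => _ dvd /dvd/orP[|/eqP-> //].
  rewrite order_eq1 => /eqP/coset_idr => /(_ nMx) Mx.
  have: x \in 'C_G[x] by rewrite inE (subsetP sMG) ?cent1id.
  by rewrite C1 => /set1P x1; move: r_pr; rewrite x1 order1.
- by rewrite -cycle_subG -quotient_cycle // quotient_norms.
have sR : M :&: [~: G, <[x]>] \subset G by rewrite subIset ?sMG.
have := strongest_coprime_quotient_cent nM sR (coprimeSg sR coGx).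
rewrite abelian_sol ?cycle_abelian ?orbT // => /(_ isT).
by rewrite quotient_cycle // !cent_cycle C1 quotient1.
Qed.

(** Solvability comes first, through Thompson's criterion when G has no proper nontrivial
    x-invariant normal subgroup. Then an elementary abelian p-group V inside G, normal in G <x>,
    yields a nontrivial centre, and induction applies to G / Z(G). *)
Theorem fpf_prime_nilpotent (gT : finGroupType) (G : {group gT}) x :
  prime #[x] -> x \in 'N(G) -> 'C_G[x] = 1 -> nilpotent G.
Proof.
have [m] := ubnP #|G|; elim: m => // m IHm in gT G x *; move=> /ltnSE-leGm r_pr nGx C1.
have [G1 | ntG] := eqsVneq G 1; first by rewrite G1 nilpotent1.
have coGx := fpf_coprime r_pr nGx C1.
have nG : <[x]> \subset 'N(G) by rewrite cycle_subG.
have solx : solvable <[x]> := abelian_sol (cycle_abelian x).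
have IHsub (H : {group gT}) : H \proper G -> x \in 'N(H) -> nilpotent H.
  move=> prH nHx; apply: (IHm _ H x) => //; first exact: leq_trans (proper_card prH) leGm.
  by apply/trivgP; rewrite -C1 setSI ?proper_sub.
have IHquo (M : {group gT}) : M <| G -> x \in 'N(M) -> M :!=: 1 -> nilpotent (G / M).
  move=> nsMG nMx ntM; have [rM nGM CM1] := fpf_quotient r_pr nGx C1 nsMG nMx.
  apply: IHm rM nGM CM1; apply: leq_trans leGm.
  by apply: ltn_quotient; rewrite ?normal_sub.
have solG : solvable G.
  have [/existsP[M /and4P[nsMG nMx ntM neMG]] | ] :=
      boolP [exists M : {group gT}, [&& M <| G, x \in 'N(M), M :!=: 1 & M != G]].
    rewrite (series_sol nsMG) !nilpotent_sol ?IHquo //.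
    by apply: IHsub; rewrite // properEneq neMG normal_sub.
  rewrite negb_exists => /forallP simpG.
  have simp (M : {group gT}) : M <| G -> x \in 'N(M) -> M :!=: 1 -> M :=: G.
    by move=> nsMG nMx ntM; have := simpG M; rewrite nsMG nMx ntM /= negbK => /eqP->.
  have [oddG | ] := boolP [exists p : 'I_#|G|.+1, [&& prime p, odd p & p %| #|G|]]; last first.
    (* With no odd prime divisor, G is a 2-group. *)
    rewrite negb_exists => /forallP no_odd; apply: (@pgroup_sol _ 2).
    apply/pgroupP=> p p_pr pG; have ltp : p < #|G|.+1 by rewrite ltnS dvdn_leq.
    by have := no_odd (Ordinal ltp); rewrite /= p_pr pG andbT; case/even_prime: p_pr => -> .
  have /existsP[[p /= _] /and3P[p_pr odd_p pG]] := oddG.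
  have [P sylP nPx] := sol_coprime_Sylow_exists p solx nG coGx.
  have pgroup_solG : p.-group G -> solvable G by apply: pgroup_sol.
  have [nilp | nnilp] := boolP (p.-group G); first exact: pgroup_solG.
  (* Up to conjugacy the Sylow subgroup is the x-invariant [P]. The normaliser of its characteristic
     subgroup [Y0] is x-invariant, so it is proper and nilpotent, or it is G and then G = [Y0] is a
     p-group. *)
  have locG : char_local_pnilpotent p G.
    move=> S Y sylS chY ntY; have [g Gg defS] := Sylow_trans sylP sylS.
    pose Y0 := (Y :^ g^-1)%G.
    have chY0 : Y0 \char P.
      by have := charJ g^-1 chY; rewrite defS conjsgK.
    have ntY0 : Y0 :!=: 1 by rewrite -cardG_gt1 cardJg cardG_gt1.
    have nYx : x \in 'N(Y0).
      by rewrite (subsetP (char_norms chY0)) // -cycle_subG.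
    have defN : 'N_G(Y) = 'N_G(Y0) :^ g by rewrite conjIg normJ conjGid // conjsgKV.
    rewrite defN pnilpotentJ.
    have [eqN | neN] := eqVneq 'N_G(Y0) G.
      case/negP: nnilp; rewrite -(simp Y0) //.
        by apply: pgroupS (char_sub chY0) (pHall_pgroup sylP).
      rewrite /normal (subset_trans (char_sub chY0) (pHall_sub sylP)).
      by apply/setIidPl.
    apply: nilpotent_pcore_Hall; apply: IHsub; first by rewrite properEneq neN subsetIl.
    by rewrite -cycle_subG normsI // norms_norm // cycle_subG.
  have := Thompson_pnilpotent p_pr odd_p locG.
  have nOx : x \in 'N('O_p^'(G)) by rewrite -cycle_subG gFnorm_trans.
  (* The x-invariant p'-core is trivial or all of G. The first makes G a p-group; the second fails
     because p divides |G|. *)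
  have [O1 | ntO] := eqVneq 'O_p^'(G) 1.
    by move/pnilpotent_index; rewrite O1 indexg1 => /pgroup_solG.
  have := simp 'O_p^'(G)%G (pcore_normal _ _) nOx ntO => /= eqO _.
  by have := pcore_pgroup p^' G; rewrite eqO /pgroup p'natE // pG.
have nsGL : G <| G <*> <[x]> by rewrite normalYl.
have [V [sVG nsVL ntV]] := solvable_norm_abelem solG nsGL ntG.
case/is_abelemP=> p p_pr abelV; have [pV abV _] := and3P abelV.
have [_ nVL] := andP nsVL.
have nVG : G \subset 'N(V) := subset_trans (joing_subl _ _) nVL.
have nVx : x \in 'N(V) by rewrite -cycle_subG (subset_trans (joing_subr _ _) nVL).
have CV1 : 'C_V[x] = 1 by apply/trivgP; rewrite -C1 setSI.
have [P sylP] := Sylow_exists p G; have [sPG pP _] := and3P sylP.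
have ntC : 'C_V(P) != 1 := pgroup_cent_nontrivial pP pV (subset_trans sPG nVG) ntV.
(* G is generated by one Sylow subgroup for each prime: P centralises C_V(P), and for q other than p
   an x-invariant Sylow q-subgroup centralises all of V by [fpf_coprime_cent]. *)
have cVPG : G \subset 'C('C_V(P)).
  pose T := [set R : {group gT} | (R \subset G) && (R \subset 'C('C_V(P)))].
  rewrite -(@Sylow_transversal_gen _ T G).
  - by rewrite gen_subG; apply/bigcupsP=> R; rewrite inE => /andP[].
  - by move=> R; rewrite inE => /andP[].
  move=> q _; have [-> | neqp] := eqVneq q p.
    by exists P; rewrite // inE sPG centsC subsetIr.
  have [Q sylQ nQx] := sol_coprime_Sylow_exists q solx nG coGx.
  have sQG := pHall_sub sylQ; exists Q; rewrite // inE sQG /=.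
  apply: subset_trans (centS (subsetIl V 'C(P))).
  apply: fpf_coprime_cent r_pr _ nVx _ abV _ CV1 _.
  - by rewrite -cycle_subG.
  - exact: subset_trans nVG.
  - by apply/trivgP; rewrite -C1 setSI.
  apply: (pnat_coprime pV); apply: sub_in_pnat (pHall_pgroup sylQ) => t _ /eqP->.
  by rewrite !inE.
have ntZ : 'Z(G) != 1.
  apply: contraNneq ntC => Z1; rewrite -subG1 -Z1 subsetI.
  by rewrite subIset ?sVG // centsC.
rewrite -quotient_center_nil; apply: IHquo => //; first exact: center_normal.
by rewrite -cycle_subG gFnorm_trans.
Qed.

End FixedPointFree.

(** * O'Nan-Scott types *)

Section QuasiSemiregular.

(** Cauchy's theorem in <g> / K, with K the kernel of the action on S; K is proper because <g> fixes
    only one point of S. The order of y is controlled on S only, since the ambient type may be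
    larger. *)
Lemma qsr_prime_power (rT : finType) (S : {set rT}) (g : {perm rT}) :
    qsr_element 'P S g -> 1 < #|S| ->
  exists y r a, [/\ y \in <[g]>, prime r, a \in S, (forall x, x \in S -> (y ^+ r) x = x)
    & forall x, x \in S -> (y x == x) = (x == a)].
Proof.
case=> a Fa semi S1.
have [Sa ga] : a \in S /\ a \in 'Fix_'P(<[g]>).
  by apply/setIP; rewrite Fa set11.
pose K := 'C_<[g]>(S | 'P)%G; have sKg : K \subset <[g]> := subsetIl _ _.
have nsKg : K <| <[g]> by rewrite -sub_abelian_normal ?cycle_abelian.
have Kfix y x : y \in K -> x \in S -> y x = x.
  by case/setIP=> _ /astabP; apply.
have ntK : <[g]> / K != 1.
  apply: contraTneq S1 => /eqP; rewrite -subG1 quotient_sub1 ?normal_norm // => sgK.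
  rewrite -leqNgt -(cards1 a) subset_leq_card // -Fa subsetI subxx.
  by apply/subsetP=> x Sx; apply/afixP=> y gy; apply: Kfix Sx; apply: (subsetP sgK).
have [/eqP | [r r_pr /(Cauchy r_pr)[yb gyb oyb]]] := trivgVpdiv (<[g]> / K)%G.
  by rewrite (negPf ntK).
case/morphimP: gyb oyb => y Ny gy -> oyb.
have Kyr : y ^+ r \in K.
  apply: coset_idr; first exact: groupX.
  by rewrite morphX // -oyb expg_order.
have nKy : y \notin K.
  by apply/negP=> /coset_id Ky; move: r_pr; rewrite -oyb /= Ky order1.
exists y, r, a; split=> // [x|x Sx]; first exact: Kfix.
apply/eqP/eqP=> [yx | ->]; last by move/afixP: ga => /(_ y gy).
apply/eqP/idPn=> neqx; case/negP: nKy; rewrite inE gy /=.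
have Sax : x \in S :\ a by rewrite !inE neqx.
by apply: (subsetP (semi x Sax)); rewrite inE gy; apply/astab1P.
Qed.

Variable Om : finType.
Implicit Types (G M : {group {perm Om}}) (a : Om).

(** An element of M commuting with the prime-order power y of g preserves the unique fixed point of
    y, so it is trivial. Thus y acts on M without fixed points and [fpf_prime_nilpotent] applies. *)
Lemma qsr_semiregular_nilpotent G M (g : {perm Om}) :
    g \in G -> qsr_element 'P [set: Om] g -> M <| G ->
    (forall a, 'C_M[a | 'P] = 1) ->
  nilpotent M.
Proof.
move=> Gg qg nsMG regM.
have [le1 | gt1] := leqP #|[set: Om]| 1.
  suff -> : M :=: 1 by apply: nilpotent1.
  apply/trivgP/subsetP=> m _; rewrite inE; apply/eqP/permP=> x.
  by apply: (card_le1_eqP le1); rewrite inE.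
have [y [r [a [gy r_pr _ yr ya]]]] := qsr_prime_power qg gt1.
have oy : #[y] = r.
  have y1 : y ^+ r = 1 by apply/permP=> x; rewrite yr ?inE ?perm1.
  have: #[y] %| r by rewrite order_dvdn y1.
  case/primeP: (r_pr) => _ dvd /dvd/orP[|/eqP//].
  rewrite order_eq1 => /eqP y_1; move: gt1; rewrite ltnNge => /negP[].
  rewrite -(cards1 a) subset_leq_card //; apply/subsetP=> x _.
  by rewrite inE -ya ?inE // y_1 perm1.
have Gy : y \in G by apply: subsetP gy; rewrite cycle_subG.
apply: (@fpf_prime_nilpotent _ M y); first by rewrite oy.
  exact: (subsetP (normal_norm nsMG)).
apply/trivgP; rewrite -(regM a); apply/subsetP=> m /setIP[Mm /cent1P cmy].
rewrite inE Mm; apply/astab1P; apply/eqP; rewrite /= /aperm -ya ?inE //.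
have yaa : y a = a by apply/eqP; rewrite ya ?inE.
by rewrite -permM cmy permM yaa.
Qed.

Lemma minnormals_min G M : M \in minnormals G ->
  [/\ M :!=: 1, M <| G &
      forall H : {group {perm Om}}, H <| G -> H :!=: 1 -> H \subset M -> H :=: M].
Proof.
rewrite inE => /mingroupP[/andP[ntM nsMG] minM]; split=> // H nsHG ntH sHM.
by apply: minM; rewrite ?ntH.
Qed.

Lemma nilpotent_minnormal_abelian G M : M \in minnormals G -> nilpotent M -> abelian M.
Proof.
case/minnormals_min=> ntM nsMG minM nilM.
have nsZ : 'Z(M) <| G by rewrite gFnormal_trans.
rewrite -(minM 'Z(M)%G) ?center_sub ?center_abelian //.
by rewrite center_nil_eq1.
Qed.

Lemma prim_normal_trans G M :
  [primitive G, on [set: Om] | 'P] -> M <| G -> M :!=: 1 -> [transitive M, on [set: Om] | 'P].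
Proof.
move=> primG nsMG ntM; case: (prim_trans_norm primG nsMG) => // sMC.
case/eqP: ntM; apply/trivgP/subsetP=> m Mm; rewrite inE; apply/eqP/permP=> x.
have /setIP[_ /astabP/(_ x)] := subsetP sMC m Mm.
by rewrite perm1 inE; apply.
Qed.

Lemma cent_trans_semiregular (A : {set {perm Om}}) M :
  [transitive M, on [set: Om] | 'P] -> A \subset 'C(M) -> forall a, 'C_A[a | 'P] \subset [1].
Proof.
move=> trM cMA a; apply/subsetP=> s /setIP[As /astab1P sa]; rewrite inE.
apply/eqP/permP=> x; have [m Mm ->] := atransP2 trM (in_setT a) (in_setT x).
rewrite /= /aperm -permM -(centsP cMA s As m Mm) permM perm1.
by rewrite [s a]sa.
Qed.

Lemma socle_gen_abelian G :
    (forall M1 M2, M1 \in minnormals G -> M2 \in minnormals G -> M1 \subset 'C(M2)) ->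
  abelian (socle G).
Proof.
move=> cMM; rewrite abelian_gen; apply/bigcupsP=> M1 GM1; rewrite centsC.
by apply/bigcupsP=> M2 GM2; rewrite centsC; apply: cMM.
Qed.

Lemma soc_stabJ G a n : n \in socle G -> soc_stab G (n a) = soc_stab G a :^ n.
Proof.
move=> Nn; rewrite /soc_stab conjIg conjGid //; congr (_ :&: _).
by rewrite -[n a]/('P%act a n) astab1_act ?inE.
Qed.

Lemma soc_stab_isogJ G a n (T : {group {perm Om}}) :
  n \in socle G -> soc_stab G a \isog T -> soc_stab G (n a) \isog T.
Proof.
move=> Nn isoT; rewrite soc_stabJ //.
have := conj_isog 'C_(socle G)[a | 'P]%G n; rewrite isog_sym => /isog_trans.
exact.
Qed.

Lemma full_projectionsJ G a n : n \in socle G -> full_projections G a -> full_projections G (n a).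
Proof.
move=> Nn fullG Ti TiG; rewrite soc_stabJ //.
transitivity ((soc_stab G a * 'C_(socle G)(Ti)) :^ n); last by rewrite (fullG Ti TiG) conjGid.
rewrite conjsMg.
have /mingroupP[/andP[_ nsTi] _] : minnormal_sub Ti (socle G) by move: TiG; rewrite inE.
congr (_ * _); rewrite conjIg conjGid // -centJ.
by rewrite (normsP (normal_norm nsTi) n Nn).
Qed.

(** Distinct minimal normal subgroups are transitive and centralise each other, hence are
    semiregular, nilpotent and abelian. So a nonabelian socle is the unique minimal normal subgroup,
    with nontrivial point stabilisers. These are conjugate under the socle, and one of them decides
    between PA, SD and CD. *)
Theorem primitive_qsr_type G :
    [primitive G, on [set: Om] | 'P] ->
    (exists2 g, g \in G & qsr_element 'P [set: Om] g) ->
  type_HA G \/ type_AS G \/ type_PA G \/ type_SD G \/ type_CD G.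
Proof.
move=> primG [g Gg qg].
have [abN | nabN] := boolP (abelian (socle G)); first by left.
have [simN | nsimN] := boolP (simple (socle G)); first by right; left.
have minN M := @minnormals_min G M.
have regM M : M \in minnormals G -> (forall a, 'C_M[a | 'P] = 1) -> abelian M.
  move=> GM regM; apply: (nilpotent_minnormal_abelian GM).
  by apply: (qsr_semiregular_nilpotent Gg qg) regM; case: (minN M GM).
have trM M : M \in minnormals G -> [transitive M, on [set: Om] | 'P].
  by case/minN=> ntM nsMG _; apply: prim_normal_trans primG nsMG ntM.
have cMM M1 M2 : M1 \in minnormals G -> M2 \in minnormals G -> M1 != M2 -> M1 \subset 'C(M2).
  move=> GM1 GM2 neM; have [nt1 ns1 min1] := minN M1 GM1; have [nt2 ns2 min2] := minN M2 GM2.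
  apply/commG1P/trivgP; have ti12 : M1 :&: M2 = 1.
    apply/eqP/idPn=> nt12; have ns12 : (M1 :&: M2)%G <| G := normalI ns1 ns2.
    case/negP: neM; apply/eqP/val_inj; rewrite /=.
    by rewrite -(min1 _ ns12 nt12 (subsetIl _ _)) (min2 _ ns12 nt12 (subsetIr _ _)).
  have n12 : M1 \subset 'N(M2) := subset_trans (normal_sub ns1) (normal_norm ns2).
  have n21 : M2 \subset 'N(M1) := subset_trans (normal_sub ns2) (normal_norm ns1).
  by rewrite -ti12 subsetI commg_subl n21 commg_subr.
have [M GM] : exists M, M \in minnormals G.
  apply/set0Pn; apply: contraNneq nabN => no_min.
  by rewrite /socle no_min big_set0 gen0 abelian1.
have uniqM M' : M' \in minnormals G -> M' = M.
  move=> GM'; apply/eqP/idPn=> neM; case/negP: nabN.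
  have abM M1 : M1 \in minnormals G -> abelian M1.
    move=> GM1; apply: (regM M1 GM1) => a.
    have [M2 GM2 ne21] : exists2 M2, M2 \in minnormals G & M1 != M2.
      by have [-> | ne1] := eqVneq M1 M; [exists M'; rewrite // eq_sym | exists M].
    apply/trivgP; apply: cent_trans_semiregular (trM M2 GM2) (cMM _ _ GM1 GM2 ne21) a.
  apply: socle_gen_abelian => M1 M2 GM1 GM2.
  by have [-> | ne12] := eqVneq M1 M2; [apply: abM | apply: cMM].
have defS : minnormals G = [set M].
  apply/setP=> M'; rewrite in_set1; apply/idP/eqP=> [/uniqM// | -> //].
have defN : socle G = M by rewrite /socle defS big_set1 genGid.
have uniqN : uniq_nonab_socle G by split; rewrite // defS cards1.
have [a0] : exists a0 : Om, true.
  case/andP: primG => trG _; have /imsetP[a _ _] := trG; by exists a.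
move=> _; have trN : [transitive socle G, on [set: Om] | 'P] by rewrite defN; apply: trM.
have allN (P : Om -> Prop) :
    (forall a n, n \in socle G -> P a -> P (n a)) -> forall a b, P a -> P b.
  by move=> PN a b Pa; have [n Nn ->] := atransP2 trN (in_setT a) (in_setT b); apply: PN.
have ntstab a : soc_stab G a != 1.
  apply/negP=> /eqP regN; case/negP: nabN; rewrite defN; apply: (regM M GM) => b.
  rewrite -defN; apply: (allN (fun b => soc_stab G b = 1) _ a b regN) => c n Nn regc.
  by rewrite soc_stabJ // regc conjs1g.
right; right.
have [full | nfull] := boolP
    [forall Ti in soc_factors G, soc_stab G a0 * 'C_(socle G)(Ti) == socle G]; last first.
  left; split=> // a; split=> // fullG; case/negP: nfull; apply/forall_inP=> Ti TiG; apply/eqP.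
  by apply: (allN (full_projections G) _ a a0 fullG) TiG => c n; apply: full_projectionsJ.
have fullG a : full_projections G a.
  apply: (allN (full_projections G) _ a0) => [c n|Ti TiG]; first exact: full_projectionsJ.
  exact/eqP/(forall_inP full).
right; have [/exists_inP[Ti TiG isoT] | niso] := boolP
    [exists Ti in soc_factors G, soc_stab G a0 \isog (Ti : {group {perm Om}})].
  left; split=> // a; split=> //; exists Ti => //.
  apply: (allN (fun b => soc_stab G b \isog Ti) _ a0 a isoT) => c n Nn iso.
  exact: soc_stab_isogJ.
right; split=> // a; split=> // Ti TiG; apply: contra niso => iso.
apply/exists_inP; exists Ti => //.
apply: (allN (fun b => soc_stab G b \isog Ti) _ a a0 iso) => c n Nn isoc.
exact: soc_stab_isogJ.
Qed.

End QuasiSemiregular.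

(** * Product action *)

Section PrimeCycles.

Lemma gen_closed_ind (gT : finGroupType) (A : {set gT}) (P : gT -> Prop) :
    P 1 -> (forall x, x \in A -> P x) -> (forall x y, P x -> P y -> P (x * y)) ->
  forall x, x \in <<A>> -> P x.
Proof.
move=> P1 PA PM x /gen_prodgP[n [c Ac ->]].
by apply: big_ind => // i _; apply: PA.
Qed.

(** If r does not divide n, then s is a power of [s ^+ n] and fixes whatever that fixes. *)
Lemma permX_fix_prime (T : finType) (s : {perm T}) r n i :
  prime r -> s ^+ r = 1 -> (s ^+ n) i = i -> s i != i -> r %| n.
Proof.
move=> r_pr sr sni; apply: contraR => rn.
have co : coprime #[s] n.
  have dvd : #[s] %| r by rewrite order_dvdn sr.
  by apply: coprime_dvdl dvd _; rewrite prime_coprime.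
rewrite -{1}(expgK co (cycle_id s)) permX; apply/eqP.
by elim: (expg_invn _ _) => //= m ->.
Qed.

(** An r-periodic sequence can be spread consistently along the r-cycle of s through i0. This builds
    the unwanted fixed points in both the product and the diagonal action. *)
Lemma prime_cycle_assign k (U : finType) (s : 'S_k) r i0 (v : nat -> U) (f0 : {ffun 'I_k -> U}) :
    prime r -> s ^+ r = 1 -> s i0 != i0 -> (forall m, v (m + r)%N = v m) ->
  exists2 f : {ffun 'I_k -> U}, forall m, f ((s ^+ m) i0) = v m
    & forall i, i \notin porbit s i0 -> f i = f0 i.
Proof.
move=> r_pr sr si0 vr.
exists [ffun i => if [pick m : 'I_r | (s ^+ m) i0 == i] is Some m then v m else f0 i].
  move=> m; rewrite ffunE; have vmod n : v n = v (n %% r).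
    rewrite {1}(divn_eq n r) addnC; elim: (n %/ r) => [|q IHq]; first by rewrite addn0.
    by rewrite mulSn (addnC r) addnA vr.
  case: pickP => [m' /eqP eqm | /(_ (Ordinal (ltn_pmod m (prime_gt0 r_pr))))]; last first.
    by rewrite /= (expg_mod m sr) eqxx.
  have eqmod n1 n2 : n1 <= n2 -> (s ^+ n1) i0 = (s ^+ n2) i0 -> n1 = n2 %[mod r].
    move=> le12 eq12; apply/esym/eqP; rewrite eqn_mod_dvd //.
    apply: (permX_fix_prime (s := s) (i := i0)) => //.
    by apply: (@perm_inj _ (s ^+ n1)); rewrite -permM -expgD subnK.
  rewrite (vmod m) (vmod m'); congr v.
  by have [/eqmod | /ltnW/eqmod] := leqP m' m => [-> // | <-].
move=> i; rewrite ffunE; case: pickP => // m /eqP <-.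
by rewrite mem_porbit.
Qed.

End PrimeCycles.

Section WreathProduct.

Variables (Delta : finType) (H : {group {perm Delta}}) (l : nat).
Notation fT := {ffun 'I_l -> Delta}.

Definition wreath_rep (g : {perm fT}) (s : 'S_l) :=
  exists2 h : 'I_l -> {perm Delta}, forall i, h i \in H
    & forall (f : fT) i, g f i = h i (f (s^-1 i)).

Lemma wreath_rep1 : wreath_rep 1 1.
Proof. by exists (fun=> 1) => [i | f i]; rewrite ?group1 // invg1 !perm1. Qed.

Lemma wreath_repM g1 g2 s1 s2 :
  wreath_rep g1 s1 -> wreath_rep g2 s2 -> wreath_rep (g1 * g2) (s1 * s2).
Proof.
case=> h1 Hh1 E1 [h2 Hh2 E2]; exists (fun i => h1 (s2^-1 i) * h2 i) => [i | f i].
  by rewrite groupM.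
by rewrite permM E2 E1 invMg !permM.
Qed.

Lemma wreath_repX g s n : wreath_rep g s -> wreath_rep (g ^+ n) (s ^+ n).
Proof.
move=> rep; elim: n => [|n IHn]; first exact: wreath_rep1.
by rewrite !expgSr; apply: wreath_repM.
Qed.

Lemma wreath_PA_rep g : g \in wreath_PA H l -> exists s, wreath_rep g s.
Proof.
move: g; apply: (@gen_closed_ind _ _ (fun g => exists s, wreath_rep g s))
  => [|x /setUP[/imsetP[h Hh ->] | /imsetP[s _ ->]] | x y [s1 rep1] [s2 rep2]].
- by exists 1; apply: wreath_rep1.
- exists 1, h => [i | f i]; last by rewrite permE ffunE invg1 perm1.
  by move: Hh; rewrite inE => /forallP.
- by exists s, (fun=> 1) => [i | f i]; rewrite ?group1 // permE ffunE perm1.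
by exists (s1 * s2); apply: wreath_repM.
Qed.

(** If s moved i, changing coordinate i of f would leave coordinate i of g f unchanged. *)
Lemma wreath_rep_id g s :
  1 < #|Delta| -> wreath_rep g s -> (forall f, g f = f) -> s = 1.
Proof.
case/card_gt1P=> d1 [d2 [_ _ neq_d]] [h _ E] g1; apply/permP=> i; rewrite perm1.
apply/eqP/idPn=> nei; case/eqP: neq_d.
have nej : (s^-1 i == i) = false.
  by apply: contraNF nei => /eqP e; rewrite -{1}e permKV.
pose f (d : Delta) : fT := [ffun j => if j == i then d else d1].
have fE d : f d i = h i d1 by rewrite -{1}(g1 (f d)) E ffunE nej.
by have := fE d2; rewrite -(fE d1) !ffunE eqxx.
Qed.

Lemma wreath_PA_qsr :
    1 < #|Delta| -> 1 < l ->
  (exists2 g, g \in wreath_PA H l & qsr_element 'P [set: fT] g)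
    <-> (exists2 h, h \in H & qsr_element 'P [set: Delta] h).
Proof.
move=> D1 l1; have l0 : 0 < l := ltnW l1; pose i0 := Ordinal l0.
split=> [[g Wg qg] | [h Hh [a Fa semi]]].
  have [d1 [d2 [_ _ neq_d]]] := card_gt1P D1.
  have S1 : 1 < #|[set: fT]|.
    apply/card_gt1P; exists [ffun=> d1], [ffun=> d2]; split; rewrite ?inE //.
    by apply: contraNneq neq_d => /ffunP/(_ i0); rewrite !ffunE => ->.
  have [y [r [a [gy r_pr _ yr ya]]]] := qsr_prime_power qg S1.
  have{yr} yr f : (y ^+ r) f = f by apply: yr; rewrite inE.
  have{ya} ya f : (y f == f) = (f == a) by apply: ya; rewrite inE.
  have yaa : y a = a by apply/eqP; rewrite ya.
  have [s rep] : exists s, wreath_rep y s.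
    by apply: wreath_PA_rep; apply: subsetP gy; rewrite cycle_subG.
  have sr : s ^+ r = 1 := wreath_rep_id D1 (wreath_repX r rep) yr.
  have [h Hh E] := rep.
  have s1 : s = 1.
    apply/permP=> i; rewrite perm1; apply/eqP/idPn=> si.
    have [d ned] : exists d, d != a i.
      by have [eqd | ] := eqVneq d1 (a i); [exists d2; rewrite -eqd eq_sym | exists d1].
    (* Reading the y-orbit of [e] along the cycle of s through i gives an r-periodic sequence.
       Spread over that cycle, with [a] elsewhere, it is a fixed point of y differing from [a] at
       i. *)
    pose e : fT := [ffun j => if j == i then d else a j].
    pose v m := (y ^+ m) e ((s ^+ m) i).
    have vr m : v (m + r)%N = v m.
      by rewrite /v !expgD sr mulg1 permM yr.
    have [f fv fa] := prime_cycle_assign a r_pr sr si vr.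
    have step m : y f ((s ^+ m.+1) i) = f ((s ^+ m.+1) i).
      rewrite fv E expgSr permM permK fv /v expgSr permM.
      by rewrite [RHS]E expgSr permM permK.
    have : y f == f.
      apply/eqP/ffunP=> j; have [/porbitP[m ->] | nj] := boolP (j \in porbit s i).
        (* Adding r to the exponent makes it a successor, as [step] requires, even for m = 0. *)
        have <- : (s ^+ (m + r.-1).+1) i = (s ^+ m) i.
          by rewrite -addnS prednK ?prime_gt0 // expgD sr mulg1.
        exact: step.
      rewrite fa // -[in RHS]yaa !E fa //; apply: contra nj.
      case/porbitP=> m eqm; apply/porbitP; exists m.+1.
      by rewrite expgSr permM -eqm permKV.
    rewrite ya => /eqP fa'; case/eqP: ned.
    by rewrite -fa' -[i in RHS](perm1 i) -(expg0 s) fv /v !perm1 ffunE eqxx.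
  rewrite {s rep sr}s1 in E; exists (h i0) => //.
  have{} E f i : y f i = h i (f i) by rewrite E invg1 perm1.
  have hfix x : (h i0 x == x) = (x == a i0).
    pose f : fT := [ffun j => if j == i0 then x else a j].
    have -> : (x == a i0) = (f == a).
      apply/eqP/eqP=> [eqx | <-]; last by rewrite ffunE eqxx.
      by apply/ffunP=> j; rewrite ffunE; case: eqP => [->|].
    rewrite -ya; apply/eqP/eqP=> [hx | /ffunP/(_ i0)]; last by rewrite E ffunE eqxx.
    apply/ffunP=> j; rewrite E ffunE; case: eqP => [-> // | _].
    by rewrite -E yaa.
  have yX n f i : (y ^+ n) f i = (h i ^+ n) (f i).
    elim: n => [|n IHn]; first by rewrite !perm1.
    by rewrite !expgSr !permM E IHn.
  have hr : h i0 ^+ r = 1.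
    apply/permP=> x; rewrite perm1.
    by have := yX r [ffun=> x] i0; rewrite yr !ffunE.
  have hXa n : (h i0 ^+ n) (a i0) = a i0.
    by elim: n => [|n IHn]; rewrite ?perm1 // expgSr permM IHn; apply/eqP; rewrite hfix.
  exists (a i0) => [|x].
    apply/setP=> x; rewrite in_setI in_setT in_set1 /= -hfix.
    apply/afixP/eqP => [|/eqP]; first by apply; apply: cycle_id.
    by rewrite hfix => /eqP-> _ /cycleP[n ->]; apply: hXa.
  rewrite !inE andbT -hfix => hx; apply/subsetP=> _ /setIP[/cycleP[n ->] /astab1P hnx].
  have /dvdnP[q ->] := permX_fix_prime r_pr hr hnx hx.
  by rewrite mulnC expgM hr expg1n group1.
(* Conversely, h is used in every coordinate, with the constant tuple at its fixed point as the
   fixed point of g. *)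
pose g : {perm fT} := coordperm (fun i => [ffun=> h] i).
pose A : fT := [ffun=> a].
have gX n f i : (g ^+ n) f i = (h ^+ n) (f i).
  elim: n => [|n IHn]; first by rewrite !perm1.
  by rewrite !expgSr !permM permE !ffunE IHn.
have Wg : g \in wreath_PA H l.
  apply: mem_gen; apply/setUP; left; apply/imsetP; exists [ffun=> h] => //.
  by rewrite inE; apply/forallP=> i; rewrite ffunE.
have hfix x : reflect (forall z, z \in <[h]> -> z x = x) (x == a).
  by rewrite -in_set1 -Fa in_setI in_setT; apply: (iffP afixP).
exists g => //; exists A.
  apply/setP=> f; rewrite in_setI in_setT in_set1 /=.
  apply/afixP/eqP => [fixf | -> _ /cycleP[n ->]].
    apply/ffunP=> i; rewrite ffunE; apply/eqP/hfix=> _ /cycleP[n ->].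
    have /ffunP/(_ i) := fixf _ (mem_cycle g n).
    by rewrite /= /aperm gX.
  apply/ffunP=> i; rewrite /= /aperm gX ffunE.
  by apply/(hfix _ (eqxx a)); apply: mem_cycle.
move=> f; rewrite !inE andbT => neA; apply/subsetP=> _ /setIP[/cycleP[n ->] /astab1P fixf].
have [i nei] : exists i, f i != a.
  apply/existsP/contraT; rewrite negb_exists => /forallP eqa; case/eqP: neA.
  by apply/ffunP=> i; rewrite ffunE; apply/eqP/negbNE.
have hn x : (h ^+ n) x = x.
  have Sf : f i \in [set: Delta] :\ a by rewrite !inE nei.
  have : h ^+ n \in 'C([set: Delta] | 'P).
    apply: (subsetP (semi _ Sf)); rewrite inE mem_cycle; apply/astab1P.
    by rewrite /= /aperm -gX -[in RHS]fixf.
  by move/astabP/(_ x (in_setT x)).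
by apply/astabP=> f' _; apply/ffunP=> j; rewrite /= /aperm gX hn.
Qed.

Lemma nonabelian_socle_card : ~~ abelian (socle H) -> 1 < #|Delta|.
Proof.
apply: contraR; rewrite -leqNgt => le1; have triv (A : {set {perm Delta}}) : A \subset [1].
  apply/subsetP=> s _; rewrite inE; apply/eqP/permP=> x.
  by apply: (card_le1_eqP le1).
exact: abelianS (triv _) (abelian1 _).
Qed.

End WreathProduct.

(** * Diagonal action *)

Section DiagonalType.

Variables (gT : finGroupType) (T : {group gT}) (k : nat).
Notation fT := {ffun 'I_k -> gT}.

Definition pmul (u v : fT) : fT := [ffun i => u i * v i].

Lemma powTP (f : fT) : reflect (forall i, f i \in T) (f \in powT T k).
Proof. by rewrite inE; apply: forallP. Qed.

Lemma pmul_powT u v : u \in powT T k -> v \in powT T k -> pmul u v \in powT T k.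
Proof. by move=> /powTP Tu /powTP Tv; apply/powTP=> i; rewrite ffunE groupM. Qed.

Lemma mem_rcosetD (f g : fT) :
  reflect (exists2 d, d \in T & forall i, g i = d * f i) (g \in rcosetD T f).
Proof.
apply: (iffP imsetP) => [[_ /imsetP[d Td ->] ->] | [d Td eqg]].
  by exists d => // i; rewrite !ffunE.
exists [ffun=> d]; first by apply/imsetP; exists d.
by apply/ffunP=> i; rewrite !ffunE.
Qed.

Lemma eq_rcosetD (f g : fT) :
  rcosetD T f = rcosetD T g <-> exists2 d, d \in T & forall i, g i = d * f i.
Proof.
split=> [eqfg | [d Td eqg]].
  apply/mem_rcosetD; rewrite eqfg; apply/mem_rcosetD.
  by exists 1; rewrite ?group1 // => i; rewrite mul1g.
apply/setP=> h; apply/mem_rcosetD/mem_rcosetD=> [] [c Tc eqh].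
  by exists (c * d^-1) => [|i]; rewrite ?groupM ?groupV // eqg mulgA mulgKV.
by exists (c * d) => [|i]; rewrite ?groupM // eqh eqg mulgA.
Qed.

(** The twist [c] of the left diagonal factor is the identity for right multiplications and
    coordinate shifts, and the automorphism itself for diagonal automorphisms. *)
Lemma setperm_rcosetD (p : {perm fT}) (c : {perm gT}) (f f' : fT) :
    (forall d, d \in T -> c d \in T) ->
    (forall d, d \in T -> p [ffun i => d * f i] = [ffun i => c d * f' i]) ->
  setperm p (rcosetD T f) = rcosetD T f'.
Proof.
move=> Tc Ep; rewrite permE.
have cT : c @: T = T.
  apply/eqP; rewrite eqEcard card_imset ?leqnn ?andbT; last exact: perm_inj.
  by apply/subsetP=> _ /imsetP[d Td ->]; apply: Tc.
apply/setP=> h; apply/imsetP/mem_rcosetD=> [[g /mem_rcosetD[d Td eqg] ->] | [d Td eqh]].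
  exists (c d) => [|i]; first exact: Tc.
  have -> : g = [ffun i => d * f i] by apply/ffunP=> j; rewrite ffunE.
  by rewrite Ep // ffunE.
move: Td; rewrite -cT => /imsetP[e Te def_d].
exists [ffun i => e * f i]; last by rewrite Ep //; apply/ffunP=> i; rewrite ffunE -def_d.
by apply/mem_rcosetD; exists e => // i; rewrite ffunE.
Qed.

Lemma Aut_mul (a : {perm gT}) : a \in Aut T -> {in T &, {morph a : x y / x * y}}.
Proof. by move/Aut_morphic/morphicP. Qed.

Lemma Aut_one (a : {perm gT}) : a \in Aut T -> a 1 = 1.
Proof. by move=> Ta; apply: (morph1 (Morphism (Aut_mul Ta))). Qed.

Lemma Aut_inv (a : {perm gT}) : a \in Aut T -> {in T, {morph a : x / x^-1}}.
Proof. by move=> Ta x Tx; apply: (morphV (Morphism (Aut_mul Ta)) Tx). Qed.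

Lemma Aut_expg (a : {perm gT}) n : a \in Aut T -> {in T, {morph a : x / x ^+ n}}.
Proof. by move=> Ta x Tx; apply: (morphX (Morphism (Aut_mul Ta)) n Tx). Qed.

Definition diag_rep (w : {perm {set fT}}) :=
  exists s : 'S_k, exists2 a : {perm gT}, a \in Aut T & exists2 t : fT, t \in powT T k &
  forall f, f \in powT T k -> w (rcosetD T f) = rcosetD T [ffun i => a (f (s^-1 i)) * t i].

Lemma SD_W_rep w : w \in SD_W T k -> diag_rep w.
Proof.
pose one : fT := [ffun=> 1].
have T1 : one \in powT T k by apply/powTP=> i; rewrite ffunE group1.
move: w; apply: (@gen_closed_ind _ _ diag_rep).
- exists 1, 1; rewrite ?group1 //; exists one => // f _.
  by rewrite perm1; congr (rcosetD T _); apply/ffunP=> i; rewrite !ffunE invg1 !perm1 mulg1.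
- move=> w /setUP[/setUP[] |] /imsetP[].
  + move=> t Tt ->; exists 1, 1; rewrite ?group1 //; exists t => // f _.
    apply: (@setperm_rcosetD _ 1) => d Td; first by rewrite perm1.
    by apply/ffunP=> i; rewrite permE !ffunE invg1 !perm1 mulgA.
  + move=> s _ ->; exists s, 1; rewrite ?group1 //; exists one => // f _.
    apply: (@setperm_rcosetD _ 1) => d Td; first by rewrite perm1.
    by apply/ffunP=> i; rewrite permE !ffunE !perm1 mulg1.
  move=> a Ta ->; exists 1, a => //; exists one => // f /powTP Tf.
  apply: (@setperm_rcosetD _ a) => d Td; first exact: Aut_closed.
  apply/ffunP=> i; rewrite permE !ffunE invg1 perm1 mulg1.
  exact: Aut_mul.
move=> w1 w2 [s1 [a1 Ta1 [t1 Tt1 E1]]] [s2 [a2 Ta2 [t2 Tt2 E2]]].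
move: (Tt1) (Tt2) => /powTP Pt1 /powTP Pt2.
exists (s1 * s2), (a1 * a2); first exact: groupM.
exists [ffun i => a2 (t1 (s2^-1 i)) * t2 i].
  by apply/powTP=> i; rewrite ffunE groupM ?Aut_closed.
move=> f Tf; have /powTP Pf := Tf; rewrite permM E1 // E2; last first.
  by apply/powTP=> i; rewrite ffunE groupM ?Aut_closed.
congr (rcosetD T _); apply/ffunP=> i; rewrite !ffunE invMg !permM mulgA.
by rewrite (Aut_mul Ta2) ?Aut_closed.
Qed.

(* The coordinates are recentred at f0, so that a fixed coset D f0 plays the
   role of D and w acts as the pair (b, s) of Aut(T) x Sym(k). *)
Definition fix_rep (f0 : fT) (w : {perm {set fT}}) (s : 'S_k) (b : {perm gT}) :=
  b \in Aut T /\ forall u, u \in powT T k ->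
    w (rcosetD T (pmul u f0)) = rcosetD T (pmul [ffun i => b (u (s^-1 i))] f0).

Lemma fix_repX f0 w s b n : fix_rep f0 w s b -> fix_rep f0 (w ^+ n) (s ^+ n) (b ^+ n).
Proof.
case=> Tb E; elim: n => [|n [Tbn IHn]].
  split=> [|u Tu]; first exact: group1.
  by rewrite perm1; congr (rcosetD T (pmul _ _)); apply/ffunP=> i; rewrite ffunE invg1 !perm1.
split=> [|u Tu]; first by rewrite expgSr groupM.
have /powTP Pu := Tu; rewrite expgSr permM IHn // E; last first.
  by apply/powTP=> i; rewrite ffunE Aut_closed.
by congr (rcosetD T (pmul _ _)); apply/ffunP=> i; rewrite !ffunE !expgSr invMg !permM.
Qed.

(** That D f0 is fixed yields d in T with a(f0 (s^-1 i)) t_i = d f0_i. Hence a(u) d f0 = d a(u)^d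
    f0, so the translation t is absorbed by taking for b the map a followed by conjugation by d. *)
Lemma diag_fix_rep f0 w :
    f0 \in powT T k -> diag_rep w -> w (rcosetD T f0) = rcosetD T f0 ->
  exists s b, fix_rep f0 w s b.
Proof.
move=> Tf0 [s [a Ta [t Tt E]]] wf0; have /powTP Pf0 := Tf0; have /powTP Pt := Tt.
have [d Td eqd] := (eq_rcosetD _ _).1 (etrans (esym wf0) (E _ Tf0)).
have Nd : d \in 'N(T) by apply: subsetP Td; apply: normG.
exists s, (a * conj_aut T d); split=> [|u Tu].
  by rewrite groupM // (subsetP (Aut_conj_aut T _) _ (mem_morphim _ Nd Nd)).
have /powTP Pu := Tu; rewrite E ?pmul_powT //; apply/esym/eq_rcosetD; exists d => // i.
have := eqd i; rewrite !ffunE => eqdi.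
rewrite (Aut_mul Ta) // -mulgA eqdi permM norm_conj_autE ?Aut_closed //.
by rewrite conjgE !mulgA mulgV mul1g.
Qed.

Lemma eq_rcosetD_pmul f0 (u v : fT) :
  rcosetD T (pmul u f0) = rcosetD T (pmul v f0) <-> exists2 d, d \in T & forall i, v i = d * u i.
Proof.
split=> [/eq_rcosetD[d Td eqd] | [d Td eqd]]; last first.
  by apply/eq_rcosetD; exists d => // i; rewrite !ffunE eqd mulgA.
exists d => // i; by have := eqd i; rewrite !ffunE mulgA => /mulIg.
Qed.

Definition spike (i0 : 'I_k) (x : gT) : fT := [ffun i => if i == i0 then x else 1].

Lemma spike_powT i0 x : x \in T -> spike i0 x \in powT T k.
Proof. by move=> Tx; apply/powTP=> i; rewrite ffunE; case: ifP. Qed.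

Hypotheses (k_gt1 : 1 < k) (nabT : ~~ abelian T).

Let other_index (i : 'I_k) : exists j, j != i.
Proof.
have /card_gt0P[j nej] : 0 < #|predC1 i| by rewrite cardC1 card_ord -subn1 subn_gt0.
by exists j.
Qed.

(** Tested on tuples with a single nontrivial entry. If s moved i, then b would invert every element
    of T, making T abelian. With s = 1, a second coordinate forces d = 1, whence b = 1. *)
Lemma fix_rep_trivial f0 w s b :
    fix_rep f0 w s b ->
    (forall u, u \in powT T k -> w (rcosetD T (pmul u f0)) = rcosetD T (pmul u f0)) ->
  s = 1 /\ b = 1.
Proof.
case=> Tb E w1.
have{E w1} rel u : u \in powT T k -> exists2 d, d \in T & forall i, b (u (s^-1 i)) = d * u i.
  move=> Tu; have := E u Tu; rewrite w1 // => /eq_rcosetD_pmul[d Td eqd].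
  by exists d => // i; rewrite -eqd ffunE.
have b1 := Aut_one Tb.
have s1 : s = 1.
  apply/permP=> i; rewrite perm1; apply/eqP/idPn=> si; case/negP: nabT.
  have invb x : x \in T -> b x = x^-1.
    move=> Tx; have [d Td eqd] := rel _ (spike_powT i Tx).
    have si' : (s^-1 i == i) = false by apply: contraNF si => /eqP e; rewrite -{1}e permKV.
    have := eqd (s i); rewrite !ffunE permK eqxx (negPf si) mulg1 => ->.
    by have := eqd i; rewrite !ffunE si' eqxx b1 => /esym/(canRL (mulgK _)); rewrite mul1g.
  apply/centsP=> x Tx y Ty; have := Aut_mul Tb Tx Ty.
  by rewrite !invb ?groupM // invMg => /(congr1 invg); rewrite !invMg !invgK.
split=> //; apply: (eq_Aut Tb (group1 _)) => x Tx; rewrite perm1.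
have k0 : 0 < k := ltnW k_gt1; pose i := Ordinal k0; have [j neji] := other_index i.
have [d Td eqd] := rel _ (spike_powT i Tx).
have := eqd j; rewrite !ffunE s1 invg1 perm1 (negPf neji) b1 mulg1 => d1.
by have := eqd i; rewrite !ffunE s1 invg1 perm1 eqxx -d1 mul1g.
Qed.

(** As Z(T) = 1, T embeds in Aut(T) as its inner automorphisms, on which conjugation by b is the
    action of b on T. So b becomes a group element to which [fpf_prime_nilpotent] applies. *)
Lemma fpf_Aut_nilpotent b :
  prime #[b] -> b \in Aut T -> 'Z(T) = 1 -> (forall x, x \in T -> b x = x -> x = 1) -> nilpotent T.
Proof.
move=> b_pr Tb Z1 fixb.
pose f := restrm_morphism (normG T) (conj_aut_morphism T).
have fE x y : x \in T -> y \in T -> f x y = y ^ x.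
  by move=> Tx Ty; apply: norm_conj_autE; rewrite ?(subsetP (normG T)).
have injf : 'injm f by rewrite ker_restrm ker_conj_aut -/('Z(T)) Z1.
have fAut x : x \in T -> f x \in Aut T.
  move=> Tx; have Nx := subsetP (normG T) x Tx.
  exact: subsetP (Aut_conj_aut T _) _ (mem_morphim _ Nx Nx).
have fJ x : x \in T -> f x ^ b = f (b x).
  move=> Tx; apply: (eq_Aut (A := T)); rewrite ?groupJ ?fAut ?Aut_closed // => y Ty.
  have TbV : b^-1 y \in T by rewrite Aut_closed ?groupV.
  transitivity (b ((b^-1 y) ^ x)).
    by rewrite conjgE !permM; congr (b _); apply: fE.
  transitivity (y ^ b x); last by apply/esym/fE; rewrite ?Aut_closed.
  rewrite !conjgE.
  rewrite !(Aut_mul Tb) ?groupM ?groupV // permKV; congr (_ * _).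
  exact: Aut_inv.
rewrite -(injm_nil injf (subxx T)); apply: (@fpf_prime_nilpotent _ (f @* T)%G b b_pr).
  rewrite inE; apply/subsetP=> _ /imsetP[_ /morphimP[x Tx _ ->] ->].
  by rewrite fJ // mem_morphim ?Aut_closed.
apply/trivgP/subsetP=> _ /setIP[/morphimP[x Tx _ ->] /cent1P cbx].
have eqbx : f (b x) = f x by rewrite -fJ // conjgE cbx mulKg.
rewrite (fixb x Tx); first by rewrite morph1 set11.
by apply: (injmP injf); rewrite ?Aut_closed.
Qed.

(** By Frobenius' theorem r divides the number of solutions of x^r = 1 in T, hence also the number
    of those fixed by the r-group <b>. Since 1 is one of them, there are others. *)
Lemma Aut_prime_fixed_elt b r :
    prime r -> b \in Aut T -> b ^+ r = 1 -> r %| #|T| ->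
  exists d, [/\ d \in T, d != 1, d ^+ r = 1 & b d = d].
Proof.
move=> r_pr Tb br rT.
have rb : r.-group <[b]>.
  by rewrite /pgroup -/#[b] (pnat_dvd (_ : _ %| r)) ?pnat_id // order_dvdn br.
have bX n x : x \in T -> b (x ^+ n) = b x ^+ n by apply: Aut_expg.
have b1 := Aut_one Tb.
have actb : [acts <[b]>, on 'Ldiv_r(T) | 'P].
  rewrite cycle_subG !inE /=; apply/subsetP=> x; rewrite !inE /= => /andP[Tx /eqP xr].
  by rewrite /aperm Aut_closed //= -bX // xr b1 eqxx.
have := pgroup_fix_mod rb actb; rewrite (eqP (Frobenius_Ldiv rT : #|_| %% r == 0)) => /esym/eqP Fr.
have : ~~ ('Fix_('Ldiv_r(T) | 'P)(<[b]>) \subset [1]).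
  apply/negP=> sF1; have F1 : 'Fix_('Ldiv_r(T) | 'P)(<[b]>) = [1].
    apply/eqP; rewrite eqEsubset sF1 sub1set !inE group1 expg1n eqxx /=.
    apply/subsetP=> _ /cycleP[n ->]; rewrite inE /aperm; apply/eqP.
    by elim: n => [|n IHn]; rewrite ?perm1 // expgSr permM IHn.
  by move: Fr; rewrite F1 cards1 modn_small ?prime_gt1.
case/subsetPn=> d /setIP[Ld /afixP fixd]; rewrite inE => d1.
move: Ld; rewrite !inE => /andP[Td /eqP dr].
by exists d; split=> //; apply: fixd (cycle_id b).
Qed.

Lemma card_SD_Omega_gt1 : 1 < #|SD_Omega T k|.
Proof.
have [x Tx ntx] : exists2 x, x \in T & x != 1.
  apply/exists_inP/contraT; rewrite negb_exists_in => /forall_inP T1.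
  case/negP: nabT; apply: abelianS (abelian1 _); apply/subsetP=> x Tx.
  by rewrite inE; apply/negbNE/T1.
have k0 : 0 < k := ltnW k_gt1; pose i := Ordinal k0; have [j neji] := other_index i.
apply/card_gt1P; exists (rcosetD T (spike i 1)), (rcosetD T (spike i x)).
split; [exact/imset_f/spike_powT | exact/imset_f/spike_powT |].
apply: contraNneq ntx => /eq_rcosetD[d Td eqd].
have := eqd j; rewrite !ffunE (negPf neji) mulg1 => d1.
by have := eqd i; rewrite !ffunE eqxx mulg1 -d1 => ->.
Qed.

Lemma SD_W_qsr_prime g : simple T ->
  g \in SD_W T k -> qsr_element 'P (SD_Omega T k) g -> prime k /\ coprime #|T| k.
Proof.
move=> simT Wg qg.
have [y [r [A [gy r_pr SA yr yA]]]] := qsr_prime_power qg card_SD_Omega_gt1.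
have Wy : y \in SD_W T k by apply: subsetP gy; rewrite cycle_subG.
have [f0 Tf0 defA] := imsetP SA.
have yf0 : y (rcosetD T f0) = rcosetD T f0 by rewrite -defA; apply/eqP; rewrite yA.
have [s [b rep]] := diag_fix_rep Tf0 (SD_W_rep Wy) yf0.
have Su u : u \in powT T k -> rcosetD T (pmul u f0) \in SD_Omega T k.
  by move=> Tu; apply: imset_f; apply: pmul_powT.
have [sr br] : s ^+ r = 1 /\ b ^+ r = 1.
  by apply: (fix_rep_trivial (fix_repX r rep)) => u Tu; apply: yr; apply: Su.
have [Tb E] := rep.
have b1 := Aut_one Tb.
have f0E : rcosetD T f0 = rcosetD T (pmul [ffun=> 1] f0).
  by congr (rcosetD T _); apply/ffunP=> i; rewrite !ffunE mul1g.
(* Such a tuple represents a fixed coset, necessarily D f0, so it is constant. Every contradiction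
   below comes from a nonconstant tuple of this kind. *)
have fixu u d :
    u \in powT T k -> d \in T -> (forall i, b (u (s^-1 i)) = d * u i) ->
  forall i j, u i = u j.
  move=> Tu Td eqd i j; have /eqP : y (rcosetD T (pmul u f0)) = rcosetD T (pmul u f0).
    by rewrite E //; apply/esym/eq_rcosetD_pmul; exists d => // l; rewrite ffunE.
  rewrite yA ?Su // defA f0E => /eqP/esym/eq_rcosetD_pmul[c _ eqc].
  by rewrite !eqc !ffunE.
have k0 : 0 < k := ltnW k_gt1; pose i1 := Ordinal k0; have [j1 neji1] := other_index i1.
have ntT : T :!=: 1 by case/simpleP: simT.
have Z1 : 'Z(T) = 1.
  have /simpleP[_ simp] := simT; case: (simp 'Z(T)%G (center_normal T)) => //= ZT.
  by case/negP: nabT; apply/center_idP.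
(* If s = 1, a fixed element of b placed in one coordinate gives a fixed coset, so b is
   fixed-point-free on T. Then T is nilpotent and simple, hence of prime order. *)
have [s1 | nts] := eqVneq s 1.
  exfalso; have fixb x : x \in T -> b x = x -> x = 1.
    move=> Tx bx; have := fixu (spike i1 x) 1 (spike_powT i1 Tx) (group1 T).
    move=> /(_ _ i1 j1); rewrite !ffunE eqxx (negPf neji1); apply=> i.
    by rewrite s1 invg1 perm1 mul1g !ffunE; case: ifP.
  have ob : #[b] = r.
    have : #[b] %| r by rewrite order_dvdn br.
    case/primeP: (r_pr) => _ dvd /dvd/orP[|/eqP//].
    rewrite order_eq1 => /eqP b_1; case/eqP: ntT; apply/trivgP/subsetP=> x Tx.
    by rewrite inE; apply/eqP/fixb; rewrite // b_1 perm1.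
  have nilT : nilpotent T by apply: fpf_Aut_nilpotent Tb Z1 fixb; rewrite ob.
  case/negP: nabT; apply: cyclic_abelian; apply: prime_cyclic.
  exact: simple_sol_prime (nilpotent_sol nilT) simT.
have [i0 si0] : exists i0, s i0 != i0.
  apply/existsP/contraT; rewrite negb_exists => /forallP fixs; case/eqP: nts.
  by apply/permP=> i; rewrite perm1; apply/eqP/negbNE.
have shift m : (s ^+ (m + r.-1).+1) i0 = (s ^+ m) i0.
  by rewrite -addnS prednK ?prime_gt0 // expgD sr mulg1.
(* Off a cycle missing j, put 1; on it, put the b-orbit of some x other than 1. This tuple satisfies
   [fixu] with d = 1 and is not constant. *)
have porb j : j \in porbit s i0.
  apply/idPn=> nj; have [x Tx ntx] : exists2 x, x \in T & x != 1 by apply/trivgPn.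
  have vr m : (b ^+ (m + r)) x = (b ^+ m) x by rewrite expgD br mulg1.
  have [u uv u1] := prime_cycle_assign [ffun=> 1] r_pr sr si0 vr.
  have Tu : u \in powT T k.
    apply/powTP=> i; have [/porbitP[m ->] | ni] := boolP (i \in porbit s i0).
      by rewrite uv Aut_closed ?groupX.
    by rewrite u1 // ffunE group1.
  case/eqP: ntx; have := fixu u 1 Tu (group1 T) _ i0 j.
  rewrite (u1 j nj) ffunE -{1}[i0](perm1 i0) -(expg0 s) uv perm1; apply=> i.
  rewrite mul1g; have [/porbitP[m ->] | ni] := boolP (i \in porbit s i0).
    by rewrite -shift uv expgSr permM permK uv expgSr permM.
  rewrite !u1 ?ffunE //; apply: contra ni => /porbitP[m eqm]; apply/porbitP; exists m.+1.
  by rewrite expgSr permM -eqm permKV.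
have eqkr : k = r.
  have : #|porbit s i0| = k.
    by rewrite -[RHS]card_ord; apply: eq_card => j; rewrite porb.
  have : #|porbit s i0| %| #[s] by rewrite porbitE dvdn_orbit.
  move=> dvds cardk; have : k %| r by rewrite -cardk (dvdn_trans dvds) // order_dvdn sr.
  by case/primeP: r_pr => _ dvd /dvd/orP[/eqP k1 | /eqP]; [have := k_gt1; rewrite k1|].
split; first by rewrite eqkr.
rewrite eqkr coprime_sym prime_coprime //; apply/negP=> rT.
have [d [Td ntd dr bd]] := Aut_prime_fixed_elt r_pr Tb br rT.
(* The entries d^-m along the cycle, with d of order r fixed by b, are shifted by s into d times
   themselves. *)
have vr m : d ^- (m + r) = d ^- m by rewrite expgD dr mulg1.
have [u uv _] := prime_cycle_assign [ffun=> 1] r_pr sr si0 vr.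
have Tu : u \in powT T k.
  by apply/powTP=> i; have /porbitP[m ->] := porb i; rewrite uv groupV groupX.
have e0 : u i0 = 1 by have := uv 0%N; rewrite expg0 perm1 invg1.
have e1 : u (s i0) = d^-1 by have := uv 1%N; rewrite !expg1.
have bdn n : b (d ^- n) = d ^- n.
  by rewrite (Aut_inv Tb) ?groupX // (Aut_expg _ Tb) // bd.
case/eqP: ntd; have := fixu u d Tu Td _ i0 (s i0); rewrite e0 e1 => eqd.
apply: invg_inj; rewrite invg1 -eqd // => i.
have /porbitP[m ->] := porb i; rewrite -shift.
set n := (m + _)%N; rewrite uv expgSr permM permK uv bdn expgSr invMg.
by rewrite mulKVg.
Qed.

Lemma shift_setperm_rcosetD n s (f : fT) :
  (setperm (shiftperm gT s) ^+ n) (rcosetD T f) = rcosetD T [ffun i => f ((s ^+ n)^-1 i)].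
Proof.
elim: n => [|n IHn].
  by rewrite perm1; congr (rcosetD T _); apply/ffunP=> i; rewrite ffunE invg1 perm1.
rewrite expgSr permM IHn; apply: (@setperm_rcosetD _ 1) => d Td; first by rewrite perm1.
by apply/ffunP=> i; rewrite permE !ffunE perm1 expgSr invMg permM.
Qed.

(** The cyclic shift of the coordinates is the witness. If one of its nontrivial powers fixes D u,
    the diagonal factor d satisfies d^k = 1, so d = 1 by coprimality, and u is constant. *)
Lemma prime_SD_W_qsr : prime k -> coprime #|T| k ->
  exists2 g, g \in SD_W T k & qsr_element 'P (SD_Omega T k) g.
Proof.
move=> k_pr coTk; have k0 : 0 < k := ltnW k_gt1.
pose s : 'S_k := perm (@ordS_inj k); pose g := setperm (shiftperm gT s).
pose i0 := Ordinal k0.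
have sX m (i : 'I_k) : (s ^+ m) i = (i + m) %% k :> nat.
  elim: m => [|m IHm]; first by rewrite perm1 addn0 modn_small.
  by rewrite expgSr permM permE /= IHm -addn1 modnDml addn1 addnS.
have sk : s ^+ k = 1.
  by apply/permP=> i; apply: val_inj; rewrite /= sX perm1 modnDr modn_small.
have Wg : g \in SD_W T k.
  by apply: mem_gen; rewrite !inE; apply/orP; left; apply/orP; right; apply: imset_f; rewrite inE.
have Tc c : c \in T -> [ffun=> c] \in powT T k by move=> Tc; apply/powTP=> i; rewrite ffunE.
pose A := rcosetD T ([ffun=> 1] : fT).
have SA : A \in SD_Omega T k by apply: imset_f; apply: Tc; apply: group1.
have gA n : (g ^+ n) A = A.
  by rewrite shift_setperm_rcosetD; congr (rcosetD T _); apply/ffunP=> i; rewrite !ffunE.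
have g_fix n B : B \in SD_Omega T k -> ~~ (k %| n) -> (g ^+ n) B = B -> B = A.
  case/imsetP=> u /powTP Tu -> kn; rewrite shift_setperm_rcosetD => /eq_rcosetD[d Td eqd].
  (* The relation is iterated: m = k gives d^k = 1, and m inverse to n modulo the order of s gives
     invariance of u under s itself. *)
  have itd m i : u i = d ^+ m * u ((s ^+ n ^+ m)^-1 i).
    elim: m i => [|m IHm] i; first by rewrite mul1g invg1 perm1.
    by rewrite IHm eqd ffunE mulgA -expgSr (expgS (s ^+ n) m) invMg permM.
  have d1 : d = 1.
    have dk : d ^+ k = 1.
      have := itd k i0; rewrite -expgM mulnC expgM sk expg1n invg1 perm1.
      by rewrite -{1}[u i0]mul1g => /mulIg.
    by rewrite -(expgK coTk Td) dk expg1n.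
  have us i : u (s i) = u i.
    have co : coprime #[s] n.
      apply: (@coprime_dvdl _ k); first by rewrite order_dvdn sk.
      by rewrite prime_coprime.
    have := itd (expg_invn <[s]> n) (s i).
    by rewrite d1 expg1n mul1g (expgK co (cycle_id s)) permK.
  have usX m i : u ((s ^+ m) i) = u i.
    by elim: m => [|m IHm]; rewrite ?perm1 // expgSr permM us.
  apply/eq_rcosetD; exists (u i0)^-1 => [|i]; first by rewrite groupV.
  rewrite ffunE -(usX i i0) (_ : (s ^+ i) i0 = i) ?mulVg //.
  by apply: val_inj; rewrite /= sX add0n modn_small.
exists g => //; exists A.
  apply/setP=> B; rewrite in_set1; apply/setIP/eqP=> [[SB /afixP fixB] | ->].
    apply: (g_fix 1%N) => //; first by rewrite dvdn1 neq_ltn k_gt1 orbT.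
    by have := fixB _ (cycle_id g); rewrite expg1.
  by split=> //; apply/afixP=> _ /cycleP[n ->]; apply: gA.
move=> B /setD1P[neBA SB]; apply/subsetP=> _ /setIP[/cycleP[n ->] /astab1P fixB].
have [kn | nkn] := boolP (k %| n); last by case/eqP: neBA; apply: g_fix fixB.
apply/astabP=> _ /imsetP[u _ ->]; rewrite /= /aperm shift_setperm_rcosetD.
congr (rcosetD T _); apply/ffunP=> i; rewrite ffunE.
by case/dvdnP: kn => q ->; rewrite mulnC expgM sk expg1n invg1 perm1.
Qed.

End DiagonalType.

Local Open Scope group_scope.

Theorem theorem1p1 :
  (* Main statement: the possible O'Nan--Scott types *)
  (forall (Om : finType) (G : {group {perm Om}}),
     [primitive G, on [set: Om] | 'P] ->
     (exists2 g, g \in G & qsr_element 'P [set: Om] g) ->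
     type_HA G \/ type_AS G \/ type_PA G \/ type_SD G \/ type_CD G)
  /\
  (* (a) the maximal SD group W = T^k.(Out(T) x Sym(k)) *)
  (forall (gT : finGroupType) (T : {group gT}) (k : nat),
     (1 < k)%N -> simple T -> ~~ abelian T ->
     ((exists2 g, g \in SD_W T k & qsr_element 'P (SD_Omega T k) g)
        <-> (prime k /\ coprime #|T| k)))
  /\
  (* (b) the maximal product action group H wr Sym(l) on Delta^l *)
  (forall (Delta : finType) (H : {group {perm Delta}}) (l : nat),
     (1 < l)%N -> [primitive H, on [set: Delta] | 'P] ->
     type_AS H \/ type_SD H ->
     ((exists2 g, g \in wreath_PA H l & qsr_element 'P [set: {ffun 'I_l -> Delta}] g)
        <-> (exists2 h, h \in H & qsr_element 'P [set: Delta] h))).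
Proof.
split; [|split].
- exact: primitive_qsr_type.
- move=> gT T k k_gt1 simT nabT; split=> [[g Wg qg] | [k_pr coTk]].
    exact: SD_W_qsr_prime k_gt1 nabT g simT Wg qg.
  exact: prime_SD_W_qsr.
move=> Delta H l l_gt1 _ typeH; apply: wreath_PA_qsr => //.
apply: nonabelian_socle_card (H) _.
by case: typeH => [[_ nab] | [[_ nab _] _]].
Qed.
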